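(* Let $G$ be a finite graph, $k\ge1$ an integer, $\mathcal P$ any set of $k$-profiles of $G$, and $p:=|\mathcal P|$. Let $N_{\mathsf{Ext}^k}(\mathcal P)$ and $N_{\mathsf{Loc}^k}(\mathcal P)$ be obtained with respect to the set $S$ of all proper separations of $G$ of order $<k$. Then: (i) $2(p-1)\le |N_{\mathsf{Ext}^k}(\mathcal P)|\le 4(p-1)$; (ii) $2(p-1)\le |N_{\mathsf{Loc}^k}(\mathcal P)|\le 4(p-1)$; (iii) if $G$ is $(k-1)$-connected, then $|N_{\mathsf{Ext}^k}(\mathcal P)|\le 2p$.
   Context: Separations: A separation of $G=(V,E)$ is an ordered pair $(A,B)$ with $A\cup B=V$ such that no edge joins $A\setminus B$ to $B\setminus A$; its order is $|A\cap B|$, and it is an $\ell$-separation if its order is $\ell$. It is proper if neither $A\subseteq B$ nor $B\subseteq A$. Write $(A,B)\le(C,D)$ if $A\subseteq C$ and $B\supseteq D$. Two separations are nested if one is $\le$-comparable with the other or with the other's inverse (the inverse of $(C,D)$ is $(D,C)$); otherwise they cross. A separation system is a set $S$ of separations closed under taking inverses; it is proper if all its elements are proper. An orientation of $S$ is a subset containing exactly one of $(A,B),(B,A)$ for every $(A,B)\in S$. A set $O$ of separations is consistent if there are no $(A,B),(C,D)\in O$ (not necessarily distinct) with $(D,C)\le(A,B)$. An $S$-profile is a consistent orientation $P$ of $S$ such that for all $(A,B),(C,D)\in P$ we have $(B\cap D,A\cup C)\notin P$. A $k$-profile of $G$ is an $S$-profile where $S$ is the set of all separations of $G$ of order $<k$.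 Tasks: A task is a pair $(S,\mathcal P)$ where $S$ is a proper separation system of $G$ and $\mathcal P$ is a set of profiles orienting $S$ (profiles $P$ of a larger separation system are viewed as profiles of $S$ via $P\cap S$). A separation $(A,B)\in S$ is $\mathcal P$-relevant if $(A,B)\in P$ and $(B,A)\in P'$ for some $P,P'\in\mathcal P$. The reduction of $(S,\mathcal P)$ is $(R,\mathcal P)$, where $R\subseteq S$ is the set of $\mathcal P$-relevant separations. A separation $(A,B)\in S$ is extremal in $S$ if for every $(C,D)\in S$ either $(C,D)\le(A,B)$ or $(D,C)\le(A,B)$. A profile $P\in\mathcal P$ is well separated in $S$ if the $\le$-maximal elements of $P\cap S$ are pairwise nested. A separation is locally maximal in $(S,\mathcal P)$ if it is a $\le$-maximal element of $P\cap S$ for some well separated $P\in\mathcal P$. Let $\mathsf{ext_r}(S,\mathcal P)$ be the set of all $(A,B)$ such that $(A,B)$ or $(B,A)$ is extremal in $R$, and let $\mathsf{loc_r}(S,\mathcal P)$ be the set of all $(A,B)$ such that $(A,B)$ or $(B,A)$ is locally maximal in $(R,\mathcal P)$, where $(R,\mathcal P)$ is the reduction of $(S,\mathcal P)$. Strategies: For $(\Sigma,\sigma)=(\mathsf{Ext},\mathsf{ext_r})$ or $(\mathsf{Loc},\mathsf{loc_r})$, the set $N_\Sigma(S,\mathcal P)$ is defined recursively. If $R=\emptyset$, then $N_\Sigma(S,\mathcal P):=\emptyset$. Otherwise let $N:=\sigma(S,\mathcal P)$, let $\mathcal O_N$ be the set of all consistent orientations of $N$, and for $O\in\mathcal O_N$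 let $\mathcal P_O:=\{P\in\mathcal P:O\subseteq P\}$ and let $S_O$ be the set of those $(A,B)\in S$, nested with every element of $N$, for which both $O\cup\{(A,B)\}$ and $O\cup\{(B,A)\}$ are consistent. Then $N_\Sigma(S,\mathcal P):=N\cup\bigcup_{O\in\mathcal O_N}N_\Sigma(S_O,\mathcal P_O)$. Iterated strategies: Let $\mathcal P$ be a set of $k$-profiles. For $1\le\ell\le k$ let $\mathcal P_\ell$ be the set of all $\ell$-profiles of $G$ that extend to (are contained in) a $k$-profile in $\mathcal P$, and let $\mathcal P_0:=\{\emptyset\}$. For $\Sigma\in\{\mathsf{Ext},\mathsf{Loc}\}$ put $N_0:=\emptyset$ and, for $\ell=1,\dots,k$, $$N_\ell:=N_{\ell-1}\cup\bigcup_{P\in\mathcal P_{\ell-1}}N_\Sigma\big(S^\ell,\{Q\in\mathcal P_\ell: P\subseteq Q\}\big),$$ where $S^\ell$ is the set of all proper $(\ell-1)$-separations of $G$ that are nested with every element of $N_{\ell-1}$. Then $N_{\Sigma^k}(\mathcal P):=N_k$. (So $\mathsf{Ext}^k$ and $\mathsf{Loc}^k$ are the $k$-strategies all of whose entries are $\mathsf{Ext}$, respectively $\mathsf{Loc}$.) $G$ is $(k-1)$-connected if $|V|>k-1$ and no set of fewer than $k-1$ vertices separates $G$. *)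

(* Defs.v *)
From mathcomp Require Import all_boot.
Set Implicit Arguments.
Unset Strict Implicit.
Unset Printing Implicit Defensive.

(* A graph is a symmetric irreflexive relation on a finite type of vertices;
   an ordered pair (A, B) of vertex sets is the candidate separation. *)
Notation sep V := ({set V} * {set V})%type.

Definition is_sep (V : finType) (e : rel V) (s : sep V) : bool :=
  (s.1 :|: s.2 == [set: V]) &&
  [forall x in s.1 :\: s.2, forall y in s.2 :\: s.1, ~~ e x y].

Definition sep_order (V : finType) (s : sep V) : nat := #|s.1 :&: s.2|.

Definition sep_proper (V : finType) (s : sep V) : bool :=
  ~~ (s.1 \subset s.2) && ~~ (s.2 \subset s.1).

Definition sep_inv (V : finType) (s : sep V) : sep V := (s.2, s.1).

Definition sep_le (V : finType) (s t : sep V) : bool :=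
  (s.1 \subset t.1) && (t.2 \subset s.2).

Definition nested (V : finType) (s t : sep V) : bool :=
  [|| sep_le s t, sep_le t s, sep_le s (sep_inv t) | sep_le (sep_inv t) s].

Definition seps_below (V : finType) (e : rel V) (k : nat) : {set sep V} :=
  [set s | is_sep e s & sep_order s < k].

Definition orients (V : finType) (O S : {set sep V}) : bool :=
  (O \subset S) && [forall s in S, (s \in O) (+) (sep_inv s \in O)].

(* The two separations need not be distinct: t = s forbids s.2 \subset s.1. *)
Definition consistent (V : finType) (O : {set sep V}) : bool :=
  [forall s in O, forall t in O, ~~ sep_le (sep_inv t) s].

Definition is_profile (V : finType) (S P : {set sep V}) : bool :=
  [&& orients P S, consistent P &
      [forall s in P, forall t in P, (s.2 :&: t.2, s.1 :|: t.1) \notin P]].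

Definition k_profile (V : finType) (e : rel V) (k : nat) (P : {set sep V}) :=
  is_profile (seps_below e k) P.

(* In a task (S, PP) the elements of PP may be profiles of a system larger than
   S: every notion below depends only on the traces P :&: S, for P in PP. *)
Definition relevant (V : finType) (S : {set sep V}) (PP : {set {set sep V}}) :
    {set sep V} :=
  [set s in S | [exists P in PP, s \in P] &&
                [exists P in PP, sep_inv s \in P]].

Definition extremal (V : finType) (S : {set sep V}) (s : sep V) : bool :=
  (s \in S) && [forall t in S, sep_le t s || sep_le (sep_inv t) s].

Definition maximal_in (V : finType) (X : {set sep V}) (s : sep V) : bool :=
  (s \in X) && [forall t in X, sep_le s t ==> (t == s)].

Definition well_separated (V : finType) (S P : {set sep V}) : bool :=
  [forall s, forall t,
     maximal_in (P :&: S) s && maximal_in (P :&: S) t ==> nested s t].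

Definition locally_maximal (V : finType) (S : {set sep V})
    (PP : {set {set sep V}}) (s : sep V) : bool :=
  [exists P in PP, well_separated S P && maximal_in (P :&: S) s].

Definition ext_r (V : finType) (S : {set sep V}) (PP : {set {set sep V}}) :
    {set sep V} :=
  let R := relevant S PP in
  [set s | extremal R s || extremal R (sep_inv s)].

Definition loc_r (V : finType) (S : {set sep V}) (PP : {set {set sep V}}) :
    {set sep V} :=
  let R := relevant S PP in
  [set s | locally_maximal R PP s || locally_maximal R PP (sep_inv s)].

Definition cons_orientations (V : finType) (N : {set sep V}) :
    {set {set sep V}} :=
  [set O | orients O N & consistent O].

Definition subsystem (V : finType) (S N O : {set sep V}) : {set sep V} :=
  [set s in S | [&& [forall t in N, nested s t],
                    consistent (s |: O) & consistent (sep_inv s |: O)]].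

Definition subprofiles (V : finType) (PP : {set {set sep V}})
    (O : {set sep V}) : {set {set sep V}} :=
  [set P in PP | O \subset P].

Fixpoint strategy_rec (V : finType)
    (sigma : {set sep V} -> {set {set sep V}} -> {set sep V}) (n : nat)
    (S : {set sep V}) (PP : {set {set sep V}}) : {set sep V} :=
  if n is m.+1 then
    if relevant S PP == set0 then set0 else
    let N := sigma S PP in
    N :|: \bigcup_(O in cons_orientations N)
            strategy_rec sigma m (subsystem S N O) (subprofiles PP O)
  else set0.

(* For sigma = ext_r or loc_r, the recursion depth #|S| is never a restriction:
   S_O is a proper subset of S as soon as N is nonempty. The defining recursive
   equations are strategy_extE and strategy_locE below. (Were N empty with
   R nonempty, the recursion would call itself on the same task, and its least
   solution, which is the one obtained here, is empty.) *)
Definition strategy (V : finType)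
    (sigma : {set sep V} -> {set {set sep V}} -> {set sep V})
    (S : {set sep V}) (PP : {set {set sep V}}) : {set sep V} :=
  strategy_rec sigma #|S| S PP.

Lemma subsystem_sub (V : finType) (S N O : {set sep V}) :
  subsystem S N O \subset S.
Proof. by apply/subsetP=> s; rewrite inE => /andP[]. Qed.

Lemma subsystem_proper (V : finType) (S N O : {set sep V}) (t : sep V) :
  t \in S -> t \in N -> orients O N -> subsystem S N O \proper S.
Proof.
move=> tS tN /andP[_ /forall_inP /(_ t tN) Ht].
apply/properP; split; first exact: subsystem_sub.
exists t => //; rewrite inE tS /=; apply/negP => /and3P[_ c1 c2].
have [x [xO cx]] : exists x, x \in O /\ consistent (sep_inv x |: O).
  case: (boolP (t \in O)) Ht => [tO _|_ /= tO]; first by exists t.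
  by exists (sep_inv t); split=> //; rewrite /sep_inv /= -surjective_pairing.
move/forall_inP/(_ x): cx; rewrite inE xO orbT => /(_ isT).
move/forall_inP/(_ (sep_inv x)); rewrite setU11 => /(_ isT).
by rewrite /sep_le /= !subxx.
Qed.

Lemma strategy_rec_fuel (V : finType)
    (sigma : {set sep V} -> {set {set sep V}} -> {set sep V})
    (sigmaS : forall S PP s, s \in sigma S PP ->
       exists2 t, t \in S & t \in sigma S PP)
    (n m : nat) (S : {set sep V}) (PP : {set {set sep V}}) :
  #|S| <= n -> #|S| <= m ->
  strategy_rec sigma n S PP = strategy_rec sigma m S PP.
Proof.
pose loop S PP := (sigma S PP == set0) && (subsystem S set0 set0 == S).
have loopE S' PP' j : loop S' PP' -> strategy_rec sigma j S' PP' = set0.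
  case/andP=> /eqP s0 /eqP S0; elim: j => //= j IH; case: ifP => // _.
  rewrite s0 set0U big1 // => O; rewrite inE => /andP[/andP[+ _] _].
  rewrite subset0 => /eqP->; rewrite S0.
  suff -> : subprofiles PP' set0 = PP' by [].
  by apply/setP=> P; rewrite inE sub0set andbT.
elim: n m S PP => [|n IH] [|m] S PP //=.
- rewrite leqn0 cards_eq0 => /eqP-> _; case: ifP => // /eqP[].
  by apply/setP=> s; rewrite !inE.
- move=> _; rewrite leqn0 cards_eq0 => /eqP->; case: ifP => // /eqP[].
  by apply/setP=> s; rewrite !inE.
move=> Sn Sm; have [lp|nlp] := boolP (loop S PP).
  by have := loopE S PP n.+1 lp; have := loopE S PP m.+1 lp => /= -> ->.
case: ifP => // _; congr (_ :|: _); apply: eq_bigr => O.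
rewrite inE => /andP[oO _].
suff /proper_card lt : subsystem S (sigma S PP) O \proper S.
  by apply: IH; rewrite -ltnS; apply: leq_trans lt _.
have [s0|[s /sigmaS[t tS tN]]] := set_0Vmem (sigma S PP); last first.
  exact: subsystem_proper tS tN oO.
move: nlp oO; rewrite /loop s0 eqxx /= => nS /andP[+ _].
by rewrite subset0 => /eqP->; rewrite properEneq nS subsystem_sub.
Qed.

Lemma strategyE (V : finType)
    (sigma : {set sep V} -> {set {set sep V}} -> {set sep V})
    (sigmaS : forall S PP s, s \in sigma S PP ->
       exists2 t, t \in S & t \in sigma S PP)
    (S : {set sep V}) (PP : {set {set sep V}}) :
  strategy sigma S PP =
    if relevant S PP == set0 then set0 else
    sigma S PP :|: \bigcup_(O in cons_orientations (sigma S PP))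
       strategy sigma (subsystem S (sigma S PP) O) (subprofiles PP O).
Proof.
rewrite /strategy (strategy_rec_fuel sigmaS (m := #|S|.+1)) //=.
case: ifP => // _; congr (_ :|: _); apply: eq_bigr => O _.
by apply: strategy_rec_fuel => //; apply/subset_leq_card/subsystem_sub.
Qed.

Lemma strategy_extE (V : finType) (S : {set sep V}) (PP : {set {set sep V}}) :
  strategy (@ext_r V) S PP =
    if relevant S PP == set0 then set0 else
    ext_r S PP :|: \bigcup_(O in cons_orientations (ext_r S PP))
       strategy (@ext_r V) (subsystem S (ext_r S PP) O) (subprofiles PP O).
Proof.
apply: strategyE => {}S {}PP s; rewrite inE.
have inS u : extremal (relevant S PP) u -> u \in S.
  by case/andP; rewrite inE => /andP[].
case/orP=> xs; [exists s | exists (sep_inv s)]; rewrite ?inE ?xs //;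
  exact: inS.
Qed.

Lemma strategy_locE (V : finType) (S : {set sep V}) (PP : {set {set sep V}}) :
  strategy (@loc_r V) S PP =
    if relevant S PP == set0 then set0 else
    loc_r S PP :|: \bigcup_(O in cons_orientations (loc_r S PP))
       strategy (@loc_r V) (subsystem S (loc_r S PP) O) (subprofiles PP O).
Proof.
apply: strategyE => {}S {}PP s; rewrite inE.
have inS u : locally_maximal (relevant S PP) PP u -> u \in S.
  case/exists_inP=> P _ /andP[_ /andP[]].
  by rewrite !inE => /andP[_ /andP[]].
case/orP=> xs; [exists s | exists (sep_inv s)]; rewrite ?inE ?xs //;
  exact: inS.
Qed.

Definition ell_profiles (V : finType) (e : rel V) (PP : {set {set sep V}})
    (l : nat) : {set {set sep V}} :=
  if l is 0 then [set set0]
  else [set Q | k_profile e l Q & [exists P in PP, Q \subset P]].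

Definition nested_system (V : finType) (e : rel V) (N : {set sep V})
    (m : nat) : {set sep V} :=
  [set s | [&& is_sep e s, sep_proper s, sep_order s == m
             & [forall t in N, nested s t]]].

(* The step from l to l.+1 treats the separations of order exactly l. *)
Fixpoint iterated_strategy (V : finType) (e : rel V)
    (sigma : {set sep V} -> {set {set sep V}} -> {set sep V})
    (PP : {set {set sep V}}) (k : nat) : {set sep V} :=
  if k is l.+1 then
    let N := iterated_strategy e sigma PP l in
    N :|: \bigcup_(P in ell_profiles e PP l)
            strategy sigma (nested_system e N l)
              [set Q in ell_profiles e PP l.+1 | P \subset Q]
  else set0.

Definition N_Ext (V : finType) (e : rel V) (k : nat)
    (PP : {set {set sep V}}) : {set sep V} :=
  iterated_strategy e (@ext_r V) PP k.

Definition N_Loc (V : finType) (e : rel V) (k : nat)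
    (PP : {set {set sep V}}) : {set sep V} :=
  iterated_strategy e (@loc_r V) PP k.

Definition separates (V : finType) (e : rel V) (X : {set V}) : bool :=
  [exists x in ~: X, exists y in ~: X,
     ~~ connect [rel u v | [&& u \notin X, v \notin X & e u v]] x y].

Definition n_connected (V : finType) (e : rel V) (n : nat) : bool :=
  (n < #|V|) && [forall X : {set V}, (#|X| < n) ==> ~~ separates e X].

(* Main.v *)
(* Every relevant separation that is maximal is extremal, by submodularity of the
   order; hence both strategies choose a nonempty set N that is nested with all
   relevant separations, and the recursion yields a nested set distinguishing
   all given profiles. Across levels, a distinguishing separation crossing as few
   of the earlier separations as possible crosses none of them.

   In a nested set, at most one consistent orientation contains a given maximal
   separation s (s points to a leaf of the associated tree). Deleting leaves
   gives both counts: n + 1 >= p for a distinguishing set of n inverse pairs, and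
   n <= 2(h - 1) if each pair points maximally into one of h orientations induced
   by profiles, and so each edge of the tree has an end hosting a profile. The
   bound 4(p - 1) telescopes over the recursion and over the levels, because the
   profiles of a task are partitioned among its subtasks. A profile of a task is
   used up by the one extremal separation it contains, whence 2p for Ext at a
   single level; and (k-1)-connectedness leaves only the last level nonempty. *)
Require Import Defs.
From mathcomp Require Import all_boot zify.

Set Implicit Arguments.
Unset Strict Implicit.
Unset Printing Implicit Defensive.

(** * Order and nestedness *)


Lemma sep_invK (V : finType) : involutive (@sep_inv V).
Proof. by case. Qed.

Lemma sep_le_refl (V : finType) (s : sep V) : sep_le s s.
Proof. by rewrite /sep_le !subxx. Qed.

Lemma sep_le_trans (V : finType) (t s u : sep V) :
  sep_le s t -> sep_le t u -> sep_le s u.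
Proof.
case/andP=> s1 s2 /andP[t1 t2]; apply/andP; split.
  exact: subset_trans s1 t1.
exact: subset_trans t2 s2.
Qed.

Lemma sep_le_anti (V : finType) (s t : sep V) :
  sep_le s t -> sep_le t s -> s = t.
Proof.
case: s t => [A B] [C D] /andP[/= s1 s2] /andP[/= t1 t2].
by congr pair; apply/eqP; rewrite eqEsubset ?s1 ?s2 ?t1 ?t2.
Qed.

Lemma sep_le_inv (V : finType) (s t : sep V) :
  sep_le (sep_inv s) (sep_inv t) = sep_le t s.
Proof. by rewrite /sep_le /= andbC. Qed.

Lemma sep_le_invl (V : finType) (s t : sep V) :
  sep_le (sep_inv s) t = sep_le (sep_inv t) s.
Proof. by rewrite -sep_le_inv sep_invK. Qed.

Lemma sep_le_invr (V : finType) (s t : sep V) :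
  sep_le s (sep_inv t) = sep_le t (sep_inv s).
Proof. by rewrite -sep_le_inv sep_invK. Qed.

Lemma nestedC (V : finType) (s t : sep V) : nested s t = nested t s.
Proof.
rewrite /nested (sep_le_invr t s) (sep_le_invl s t).
by rewrite !orbA [sep_le s t || _]orbC.
Qed.

Lemma nested_invr (V : finType) (s t : sep V) : nested s (sep_inv t) = nested s t.
Proof.
rewrite /nested sep_invK.
by case: (sep_le s t) (sep_le t s) (sep_le s (sep_inv t)) (sep_le (sep_inv t) s)
  => [] [] [] [].
Qed.

Lemma nested_invl (V : finType) (s t : sep V) : nested (sep_inv s) t = nested s t.
Proof. by rewrite nestedC nested_invr nestedC. Qed.

Lemma nested_le (V : finType) (s t : sep V) : sep_le s t -> nested s t.
Proof. by rewrite /nested => ->. Qed.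

(** Join and meet are the supremum and infimum for [sep_le]. The profile axiom excludes exactly
    [sep_inv (sep_join s t)] when s and t are present. *)
Definition sep_join (V : finType) (s t : sep V) : sep V :=
  (s.1 :|: t.1, s.2 :&: t.2).

Definition sep_meet (V : finType) (s t : sep V) : sep V :=
  (s.1 :&: t.1, s.2 :|: t.2).

Lemma sep_joinC (V : finType) (s t : sep V) : sep_join s t = sep_join t s.
Proof. by rewrite /sep_join setUC setIC. Qed.

Lemma sep_inv_join (V : finType) (s t : sep V) :
  sep_inv (sep_join s t) = sep_meet (sep_inv s) (sep_inv t).
Proof. by []. Qed.

Lemma le_joinl (V : finType) (s t : sep V) : sep_le s (sep_join s t).
Proof. by rewrite /sep_le subsetUl subsetIl. Qed.

Lemma le_joinr (V : finType) (s t : sep V) : sep_le t (sep_join s t).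
Proof. by rewrite sep_joinC le_joinl. Qed.

Lemma join_le (V : finType) (s t u : sep V) :
  sep_le s u -> sep_le t u -> sep_le (sep_join s t) u.
Proof.
by case/andP=> s1 s2 /andP[t1 t2]; rewrite /sep_le subUset s1 t1 subsetI s2 t2.
Qed.

Lemma meet_le (V : finType) (s t : sep V) : sep_le (sep_meet s t) s.
Proof. by rewrite /sep_le subsetIl subsetUl. Qed.

(* If s and t lie on opposite sides of u, then s <= t^*: the hypothesis excludes
   the one configuration in which the corner may cross u. *)
Lemma nested_join (V : finType) (s t u : sep V) :
  ~~ sep_le s (sep_inv t) -> nested s u -> nested t u ->
  nested (sep_join s t) u.
Proof.
move=> nst su tu; case/or4P: (su) => [su1|su1|su1|su1].
- case/or4P: tu => tu1.
  + exact/nested_le/join_le.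
  + by rewrite nestedC; apply/nested_le/(sep_le_trans tu1)/le_joinr.
  + by case/negP: nst; apply: sep_le_trans su1 _; rewrite sep_le_invr.
  + rewrite -nested_invr nestedC; apply/nested_le/(sep_le_trans tu1)/le_joinr.
- by rewrite nestedC; apply/nested_le/(sep_le_trans su1)/le_joinl.
- case/or4P: tu => tu1.
  + by case/negP: nst; apply: sep_le_trans su1 _; rewrite sep_le_inv.
  + by rewrite nestedC; apply/nested_le/(sep_le_trans tu1)/le_joinr.
  + by rewrite -nested_invr; apply/nested_le/join_le.
  + rewrite -nested_invr nestedC; apply/nested_le/(sep_le_trans tu1)/le_joinr.
- by rewrite -nested_invr nestedC; apply/nested_le/(sep_le_trans su1)/le_joinl.
Qed.

(** * Orientations, consistency and maximal elements *)

Definition inv_closed (V : finType) (X : {set sep V}) : Prop :=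
  forall s, s \in X -> sep_inv s \in X.

(** In contrast to [orients], Q may exceed X, so that a profile orients every subsystem without
    being intersected with it. *)
Definition orients_all (V : finType) (X Q : {set sep V}) : Prop :=
  forall s, s \in X -> (s \in Q) (+) (sep_inv s \in Q).

Definition distinguishes (V : finType) (s : sep V) (P Q : {set sep V}) : bool :=
  (s \in P) && (sep_inv s \in Q).

Definition pairwise_nested (V : finType) (X : {set sep V}) : Prop :=
  {in X &, forall s t, nested s t}.

Lemma orients_inv (V : finType) (X Q : {set sep V}) (s : sep V) :
  orients_all X Q -> s \in X -> (sep_inv s \in Q) = (s \notin Q).
Proof. by move=> oX /oX; case: (s \in Q); case: (sep_inv s \in Q). Qed.

Lemma orients_sub (V : finType) (X Y Q : {set sep V}) :
  Y \subset X -> orients_all X Q -> orients_all Y Q.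
Proof. by move=> /subsetP YX oX s /YX/oX. Qed.

Lemma consistentP (V : finType) (Q : {set sep V}) :
  reflect (forall s t, s \in Q -> t \in Q -> ~~ sep_le (sep_inv t) s)
          (consistent Q).
Proof.
apply: (iffP forall_inP) => [h s t sQ tQ|h s sQ].
  by have /forall_inP := h s sQ; apply.
by apply/forall_inP=> t; apply: h.
Qed.

Lemma consistent_sub (V : finType) (P Q : {set sep V}) :
  P \subset Q -> consistent Q -> consistent P.
Proof.
move=> /subsetP PQ /consistentP cQ; apply/consistentP=> s t /PQ sQ /PQ tQ.
exact: cQ.
Qed.

Lemma consistentW (V : finType) (Q : {set sep V}) (s t : sep V) :
  consistent Q -> s \in Q -> t \in Q -> sep_le (sep_inv t) s = false.
Proof. by move=> /consistentP cQ sQ tQ; apply/negbTE/cQ. Qed.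

Lemma down_closed (V : finType) (X Q : {set sep V}) (s t : sep V) :
  orients_all X Q -> consistent Q -> t \in X -> s \in Q -> sep_le t s -> t \in Q.
Proof.
move=> oQ cQ tX sQ ts; apply: contraT => tQ.
have tQ' : sep_inv t \in Q by rewrite (orients_inv oQ).
by move: (consistentW cQ sQ tQ'); rewrite sep_invK ts.
Qed.

Lemma exists_maximal (V : finType) (X : {set sep V}) (s : sep V) :
  s \in X -> exists2 t, maximal_in X t & sep_le s t.
Proof.
have [n] := ubnP #|[set u in X | sep_le s u]|; elim: n s => // n IH s ltn sX.
have [max|] := boolP (maximal_in X s); first by exists s; rewrite ?sep_le_refl.
rewrite negb_and sX /= => /forall_inPn[t tX]; rewrite negb_imply.
case/andP=> st nts; case: (IH t) => //; last first.
  by move=> u mu tu; exists u => //; apply: sep_le_trans tu.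
rewrite -ltnS; apply: leq_trans ltn; rewrite ltnS.
apply/proper_card/properP; split.
  apply/subsetP=> u; rewrite !inE => /andP[-> tu].
  exact: sep_le_trans tu.
exists s; rewrite !inE sX ?sep_le_refl //=; apply: contra nts => ts.
by rewrite (sep_le_anti ts st).
Qed.

Lemma maximal_in_le (V : finType) (X : {set sep V}) (s t : sep V) :
  maximal_in X s -> t \in X -> sep_le s t -> t = s.
Proof. by case/andP=> _ /forall_inP h /h /implyP h' /h' /eqP. Qed.

(** In two of the four nested positions t or its inverse lies above s, and maximality makes it equal
    to s. *)
Lemma maximal_nested_extremal (V : finType) (N : {set sep V}) (s t : sep V) :
  inv_closed N -> pairwise_nested N -> maximal_in N s -> t \in N ->
  sep_le t s || sep_le (sep_inv t) s.
Proof.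
move=> iN nN ms tN; have sN : s \in N by case/andP: ms.
case/or4P: (nN s t sN tN) => [st|->//|st|->]; last by rewrite orbT.
  by rewrite (maximal_in_le ms tN st) sep_le_refl.
by rewrite (maximal_in_le ms (iN _ tN) st) sep_le_refl orbT.
Qed.

(** What lies below s belongs to Q, and t is excluded when its inverse lies below s. Hence any two
    consistent orientations containing s agree on such t. *)
Lemma extremal_mem (V : finType) (X Q : {set sep V}) (s t : sep V) :
  orients_all X Q -> consistent Q -> s \in Q -> t \in X ->
  sep_le t s || sep_le (sep_inv t) s -> (t \in Q) = sep_le t s.
Proof.
move=> oQ cQ sQ tX h; have [ts|nts] := boolP (sep_le t s).
  exact: down_closed oQ cQ tX sQ ts.
rewrite (negbTE nts) /= in h; apply/negP => tQ.
by rewrite (consistentW cQ sQ tQ) in h.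
Qed.

(** * Counting nested sets by deleting leaves *)

Definition del_pair (V : finType) (N : {set sep V}) (s : sep V) : {set sep V} :=
  N :\ s :\ sep_inv s.

Lemma del_pair_closed (V : finType) (N : {set sep V}) (s : sep V) :
  inv_closed N -> inv_closed (del_pair N s).
Proof.
move=> iN t; rewrite !inE => /and3P[h1 h2 /iN ->]; rewrite andbT.
rewrite (can_eq (@sep_invK V)) h2 /=; apply: contra h1 => /eqP <-.
by rewrite sep_invK.
Qed.

Lemma del_pair_sub (V : finType) (N : {set sep V}) (s : sep V) :
  del_pair N s \subset N.
Proof. by rewrite /del_pair !subDset setUA subsetU // subxx orbT. Qed.

Lemma leq_card_del_pair (V : finType) (N : {set sep V}) (s : sep V) :
  #|N| <= #|del_pair N s|.+2.
Proof.
rewrite (cardsD1 s N) (cardsD1 (sep_inv s) (N :\ s)) addnA -add2n leq_add2r.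
by rewrite (leq_add (leq_b1 _) (leq_b1 _)).
Qed.

Lemma card_del_pair (V : finType) (N : {set sep V}) (s : sep V) :
  inv_closed N -> s \in N -> s != sep_inv s -> #|N| = #|del_pair N s|.+2.
Proof.
move=> iN sN ns; rewrite (cardsD1 s N) sN (cardsD1 (sep_inv s) (N :\ s)).
by rewrite !inE eq_sym ns iN.
Qed.

Lemma orients_neq_inv (V : finType) (X Q : {set sep V}) (s : sep V) :
  orients_all X Q -> s \in X -> s != sep_inv s.
Proof. by move=> oQ /oQ; case: eqP => // <-; rewrite addbb. Qed.

(* All members of H containing a maximal element s of N agree on N; so deleting
   s and its inverse from N costs at most one member of H. *)
Lemma distinguishing_card_lower (V : finType) (N : {set sep V})
    (H : {set {set sep V}}) :
  inv_closed N -> pairwise_nested N ->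
  (forall O, O \in H -> orients_all N O /\ consistent O) ->
  (forall O O', O \in H -> O' \in H -> O != O' ->
     exists2 s, s \in N & distinguishes s O O') ->
  2 * (#|H| - 1) <= #|N|.
Proof.
have [n] := ubnP #|N|; elim: n N H => // n IH N H ltn iN nN oH dH.
have [->|[O0 O0H]] := set_0Vmem H; first by rewrite cards0.
have [N0|[s0 s0N]] := set_0Vmem N.
  suff : #|H| <= 1 by lia.
  apply/card_le1_eqP=> O O' OH O'H; apply/eqP/negPn/negP=> nO.
  by have [s] := dH _ _ O'H OH nO; rewrite N0 inE.
have [s ms _] := exists_maximal s0N; have sN : s \in N by case/andP: ms.
have cN : #|N| = #|del_pair N s|.+2.
  by apply: card_del_pair => //; apply: orients_neq_inv (proj1 (oH _ O0H)) sN.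
pose H1 := [set O : {set sep V} in H | s \notin O].
have HH1 : #|H| <= #|H1|.+1.
  have -> : #|H| = #|H1| + #|[set O : {set sep V} in H | s \in O]|.
    rewrite -(cardsID [set O : {set sep V} | s \in O] H) addnC; congr (_ + _).
      by apply: eq_card => O; rewrite !inE andbC.
    by apply: eq_card => O; rewrite !inE.
  rewrite -addn1 leq_add2l; apply/card_le1_eqP=> O O'.
  rewrite !inE => /andP[OH sO] /andP[O'H sO']; apply/eqP/negPn/negP => nO.
  have [t tN /andP[tO' tO]] := dH _ _ O'H OH nO.
  have [oO cO] := oH _ OH; have [oO' cO'] := oH _ O'H.
  have ext := maximal_nested_extremal iN nN ms tN.
  move: tO; rewrite (orients_inv oO tN) (extremal_mem oO cO sO tN ext).
  by rewrite -(extremal_mem oO' cO' sO' tN ext) tO'.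
have sub := del_pair_sub N s; have /subsetP sub' := sub.
suff : 2 * (#|H1| - 1) <= #|del_pair N s| by lia.
apply: IH.
- by lia.
- exact: del_pair_closed.
- by move=> t u /sub' tN /sub' uN; apply: nN.
- move=> O; rewrite inE => /andP[/oH[oO cO] _]; split=> //.
  exact: orients_sub oO.
(* Both O and O' avoid s, so a separation distinguishing them is neither s nor its inverse and
   survives the deletion. *)
move=> O O'; rewrite !inE => /andP[OH sO] /andP[O'H sO'] nO.
have [t tN dt] := dH _ _ OH O'H nO; exists t => //.
case/andP: dt => tO tO'; rewrite !inE tN andbT; apply/andP; split.
  apply: contraNneq sO' => E; move: tO'.
  by rewrite E sep_invK.
by apply: contraNneq sO => <-.
Qed.

(* Delete a maximal element s of N together with the members of H that contain
   it. An edge t all of whose members of H are deleted lies directly behind s,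
   and there is at most one: t^* is maximal in a member of H, as s > t. *)
Lemma hosted_card_upper (V : finType) (N : {set sep V}) (H : {set {set sep V}}) :
  inv_closed N -> pairwise_nested N ->
  (forall O, O \in H -> orients_all N O /\ consistent O) ->
  (forall s, s \in N -> exists2 O, O \in H & s \in O) ->
  (forall s, s \in N -> exists2 O, O \in H &
     maximal_in (O :&: N) s || maximal_in (O :&: N) (sep_inv s)) ->
  #|N| <= 4 * (#|H| - 1).
Proof.
have [n] := ubnP #|N|; elim: n N H => // n IH N H ltn iN nN oH rel max.
have [N0|[s0 s0N]] := set_0Vmem N; first by rewrite N0 cards0.
have [s ms _] := exists_maximal s0N; have sN : s \in N by case/andP: ms.
have ext t := maximal_nested_extremal iN nN ms (t := t).
pose H1 := [set O : {set sep V} in H | s \notin O].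
have ltH : #|H1| < #|H|.
  have [O OH sO] := rel _ sN; apply/proper_card/properP; split.
    by apply/subsetP=> O'; rewrite inE => /andP[].
  by exists O; rewrite // inE sO andbF.
have H1_gt0 : 0 < #|H1|.
  have [O OH sO] := rel _ (iN _ sN); apply/card_gt0P; exists O.
  by rewrite inE OH -(orients_inv (proj1 (oH _ OH)) sN).
(* The induction step for either deletion: the loss of a member of H pays for at most four elements
   of N, and [H1_gt0] keeps the subtraction from truncating. *)
have step (M : {set sep V}) : inv_closed M -> M \subset del_pair N s ->
    #|N| <= #|M| + 4 ->
    (forall u, u \in M -> exists2 O, O \in H1 & u \in O) ->
    #|N| <= 4 * (#|H| - 1).
  move=> iM sub cM relM; have MN := subset_trans sub (del_pair_sub N s).
  have /subsetP MN' := MN.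
  suff : #|M| <= 4 * (#|H1| - 1) by lia.
  apply: IH => //.
  - rewrite -ltnS; apply: leq_trans ltn; rewrite ltnS; apply/proper_card/properP.
    split=> //; exists s => //; apply/negP => /(subsetP sub).
    by rewrite !inE eqxx andbF.
  - by move=> t u /MN' tN /MN' uN; apply: nN.
  - move=> O; rewrite inE => /andP[/oH[oO cO] _]; split=> //.
    exact: orients_sub oO.
  (* An orientation in which u is maximal cannot contain s, since u would then lie strictly below s.
     So it survives in [H1]. *)
  have maxM O u : u \in M -> O \in H -> maximal_in (O :&: N) u ->
      O \in H1 /\ maximal_in (O :&: M) u.
    move=> uM OH mu; have [oO cO] := oH _ OH; have uN := MN' _ uM.
    have uO : u \in O by case/andP: mu; rewrite inE => /andP[].
    split; last first.
      rewrite /maximal_in inE uO uM /=; apply/forall_inP => w; rewrite inE.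
      case/andP=> wO wM; apply/implyP=> uw; apply/eqP.
      by apply: maximal_in_le mu _ uw; rewrite inE wO MN'.
    rewrite inE OH; apply/negP => sO.
    have us : sep_le u s by rewrite -(extremal_mem oO cO sO uN (ext _ uN)).
    have E : s = u by apply: maximal_in_le mu _ us; rewrite inE sO.
    by move: (subsetP sub _ uM); rewrite -E !inE eqxx andbF.
  move=> u uM; have [O OH /orP[mu|mu]] := max _ (MN' _ uM).
    by have [OH1 mu'] := maxM _ _ uM OH mu; exists O; rewrite ?mu'.
  by have [OH1 mu'] := maxM _ _ (iM _ uM) OH mu; exists O; rewrite ?mu' ?orbT.
(* If every remaining element still belongs to a member of [H1], deleting the pair of s suffices;
   otherwise the pair of some t is deleted too. *)
have [/forall_inP all|] :=
    boolP [forall t in del_pair N s, [exists O in H1, t \in O]].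
  apply: (step (del_pair N s)) => //.
  - exact: del_pair_closed.
  - by have := leq_card_del_pair N s; lia.
  - by move=> u /all /exists_inP.
case/forall_inPn=> t tM /exists_inPn tH1.
have iD := del_pair_closed (s := s) iN.
have DN := subsetP (del_pair_sub N s).
have behind u : u \in del_pair N s -> (forall O, O \in H1 -> u \notin O) ->
    (sep_le u s) * (u \in N) *
    (forall O, O \in H1 -> sep_inv u \in O).
  move=> uM uH1; have uN := DN _ uM; split; first split=> //.
    have [O OH uO] := rel _ uN; have [oO cO] := oH _ OH.
    have sO : s \in O by apply: contraLR uO => sO; apply: uH1; rewrite inE OH.
    by rewrite -(extremal_mem oO cO sO uN (ext _ uN)).
  move=> O OH1; move: (OH1) (uH1 _ OH1); rewrite inE => /andP[/oH[oO _] _].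
  by rewrite (orients_inv oO uN).
have inv_max u : u \in del_pair N s -> (forall O, O \in H1 -> u \notin O) ->
    exists2 O, O \in H1 & maximal_in (O :&: N) (sep_inv u).
  move=> uM uH1; have [[us uN] uinv] := behind _ uM uH1.
  have [O OH /orP[mu|mu]] := max _ uN; have [oO cO] := oH _ OH.
    have uO : u \in O by case/andP: mu; rewrite inE => /andP[].
    have sO : s \in O by apply: contraLR uO => sO; apply: uH1; rewrite inE OH.
    have E : s = u by apply: maximal_in_le mu _ us; rewrite inE sO.
    by move: uM; rewrite -E !inE eqxx andbF.
  exists O => //; rewrite inE OH; apply/negP => sO.
  have : sep_inv u \in O by case/andP: mu; rewrite inE => /andP[].
  rewrite (orients_inv oO uN) (extremal_mem oO cO sO uN (ext _ uN)).
  by rewrite us.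
have [Ot OtH1 mt] := inv_max _ tM tH1.
have tN := DN _ tM.
apply: (step (del_pair (del_pair N s) t)).
- exact: del_pair_closed.
- exact: del_pair_sub.
- have := leq_card_del_pair N s; have := leq_card_del_pair (del_pair N s) t.
  by lia.
move=> u; rewrite {1}/del_pair !inE => /and3P[u1 u2 u3].
have uD : u \in del_pair N s by rewrite /del_pair !inE.
apply/exists_inP; apply: contraT => /exists_inPn uH1.
have [[us uN] uinv] := behind _ uD uH1; have [[ts _] tinv] := behind _ tM tH1.
have [Ou OuH1 mu] := inv_max _ uD uH1.
have Ht := proj2 (oH Ot _); have Hu := proj2 (oH Ou _).
have OtH : Ot \in H by move: OtH1; rewrite inE => /andP[].
have OuH : Ou \in H by move: OuH1; rewrite inE => /andP[].
(* A second element u like t is impossible in every position: if u and t are comparable, maximality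
   makes their inverses coincide; otherwise the inverses are inconsistent in [Ot], or u and t are
   inconsistent in a member of H containing s. *)
case/or4P: (nN u t uN tN) => h.
- have E : sep_inv u = sep_inv t.
    apply: maximal_in_le mt _ _; first by rewrite inE uinv // iN.
    by rewrite sep_le_inv.
  by rewrite (can_inj (@sep_invK V) E) eqxx in u2.
- have E : sep_inv t = sep_inv u.
    apply: maximal_in_le mu _ _; first by rewrite inE tinv // iN.
    by rewrite sep_le_inv.
  by rewrite (can_inj (@sep_invK V) E) eqxx in u2.
- move: (consistentW (Ht OtH) (tinv _ OtH1) (uinv _ OtH1)).
  by rewrite sep_invK h.
- have [O OH sO] := rel _ sN; have [oO cO] := oH _ OH.
  have uO : u \in O by rewrite (extremal_mem oO cO sO uN (ext _ uN)).
  have tO : t \in O by rewrite (extremal_mem oO cO sO tN (ext _ tN)).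
  by move: (consistentW cO uO tO); rewrite h.
Qed.

(** * Tasks and strategies *)

(* The two corner conditions are what submodularity of the order yields for the
   separations of one fixed order (see [level_task]); unlike submodularity, they
   are inherited by the subtasks of the recursion. *)
Record task (V : finType) (S : {set sep V}) (PP : {set {set sep V}}) : Prop :=
  Task {
    task_inv : inv_closed S;
    task_orients : forall Q, Q \in PP -> orients_all S Q;
    task_cons : forall Q, Q \in PP -> consistent Q;
    task_profile : forall Q s t, Q \in PP -> s \in Q -> t \in Q ->
      sep_inv (sep_join s t) \notin Q;
    task_corner2 : forall s t P Q, s \in S -> t \in S -> P \in PP -> Q \in PP ->
      distinguishes s P Q -> distinguishes t P Q -> sep_join s t \in S;
    task_corner3 : forall s t P1 P2 P3, s \in S -> t \in S ->
      P1 \in PP -> P2 \in PP -> P3 \in PP -> s \in P1 -> t \in P1 ->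
      distinguishes s P3 P2 -> distinguishes t P2 P3 -> ~~ sep_le s t ->
      sep_join s (sep_inv t) \in S }.

Lemma relevantP (V : finType) (S : {set sep V}) (PP : {set {set sep V}})
    (s : sep V) :
  reflect (s \in S /\ exists P Q, [/\ P \in PP, Q \in PP & distinguishes s P Q])
          (s \in relevant S PP).
Proof.
rewrite inE; apply: (iffP and3P) => [[sS]|[sS [P [Q [PPP QPP /andP[sP sQ]]]]]].
  case/exists_inP=> P PPP sP /exists_inP[Q QPP sQ]; split=> //.
  by exists P, Q; rewrite /distinguishes sP.
by split=> //; apply/exists_inP; [exists P | exists Q].
Qed.

Lemma relevant_sub (V : finType) (S : {set sep V}) (PP : {set {set sep V}}) :
  relevant S PP \subset S.
Proof. by apply/subsetP=> s /relevantP[]. Qed.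

Lemma relevant_closed (V : finType) (S : {set sep V}) (PP : {set {set sep V}}) :
  inv_closed S -> inv_closed (relevant S PP).
Proof.
move=> iS s /relevantP[sS [P [Q [PPP QPP /andP[sP sQ]]]]]; apply/relevantP.
by split; [apply: iS | exists Q, P; rewrite /distinguishes sep_invK sP sQ].
Qed.

Lemma relevant_mono (V : finType) (S S' : {set sep V})
    (PP PP' : {set {set sep V}}) :
  S \subset S' -> PP \subset PP' -> relevant S PP \subset relevant S' PP'.
Proof.
move=> /subsetP SS /subsetP PPs; apply/subsetP=> s.
case/relevantP=> sS [P [Q [PPP QPP d]]]; apply/relevantP; split; first exact: SS.
by exists P, Q; split=> //; apply: PPs.
Qed.

(** The profile axiom puts the corner into P; consistency keeps it out of Q, since it lies above
    s. *)
Lemma join_distinguishes (V : finType) (S : {set sep V})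
    (PP : {set {set sep V}}) (s t : sep V) (P Q : {set sep V}) :
  task S PP -> P \in PP -> Q \in PP -> sep_join s t \in S -> t \in P ->
  distinguishes s P Q -> distinguishes (sep_join s t) P Q.
Proof.
move=> T PPP QPP jS tP /andP[sP sQ].
have := task_profile T PPP sP tP.
rewrite (orients_inv (task_orients T PPP) jS) negbK /distinguishes => -> /=.
rewrite (orients_inv (task_orients T QPP) jS); apply/negP => jQ.
by move: (consistentW (task_cons T QPP) jQ sQ); rewrite sep_invK le_joinl.
Qed.

Lemma maximal_relevant_extremal (V : finType) (S : {set sep V})
    (PP : {set {set sep V}}) (s : sep V) :
  task S PP -> maximal_in (relevant S PP) s -> extremal (relevant S PP) s.
Proof.
move=> T ms; have sR : s \in relevant S PP by case/andP: ms.
rewrite /extremal sR; apply/forall_inP=> t tR.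
(* The corner is again relevant and lies above s, so it equals s by maximality. *)
have joined u (P Q : {set sep V}) : sep_join s u \in S -> u \in P ->
    P \in PP -> Q \in PP -> distinguishes s P Q -> sep_le u s.
  move=> jS uP PPP QPP d.
  rewrite -[X in sep_le _ X](maximal_in_le ms _ (le_joinl s u)).
    exact: le_joinr.
  apply/relevantP; split=> //; exists P, Q.
  by split=> //; apply: (join_distinguishes T).
have /relevantP[sS [P [Q [PPP QPP dPQ]]]] := sR.
apply: contraT; rewrite negb_or => /andP[nts nts'].
have sP : s \in P by case/andP: dPQ.
have sQ : sep_inv s \in Q by case/andP: dPQ.
(* The claim is symmetric under t <-> t^*, so t may be assumed to lie in P. *)
have [u [uR uP nus nus']] : exists u, [/\ u \in relevant S PP, u \in P,
    ~~ sep_le u s & ~~ sep_le (sep_inv u) s].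
  have tS := subsetP (relevant_sub S PP) _ tR.
  have [tP|tP] := boolP (t \in P); first by exists t.
  exists (sep_inv t); rewrite sep_invK; split=> //.
    exact: relevant_closed (task_inv T) _ tR.
  by rewrite (orients_inv (task_orients T PPP)).
have uS := subsetP (relevant_sub S PP) _ uR.
have both (P' Q' : {set sep V}) : P' \in PP -> Q' \in PP -> distinguishes s P' Q' ->
    distinguishes u P' Q' -> False.
  move=> PPP' QPP' ds du; have uP' : u \in P' by case/andP: du.
  case/negP: nus; apply: (joined _ P' Q') => //.
  exact: (task_corner2 T sS uS PPP' QPP' ds du).
(* By [both], no two profiles are distinguished alike by s and u. Hence P contains s and u, Q
   contains u and the inverse of s, and [Q3] contains s and the inverse of u: the configuration of
   [task_corner3]. *)
have uQ : u \in Q.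
  apply: contraT => nuQ; case: (both P Q) => //.
  by rewrite /distinguishes uP (orients_inv (task_orients T QPP)).
have /relevantP[_ [_ [Q3 [_ QPP3 /andP[_ uQ3]]]]] := uR.
have sQ3 : s \in Q3.
  apply: contraT => nsQ3; case: (both P Q3) => //; rewrite /distinguishes ?uP //.
  by rewrite sP (orients_inv (task_orients T QPP3)).
case/negP: nus'; apply: (joined _ Q3 Q) => //; last by rewrite /distinguishes sQ3.
apply: (task_corner3 T (P1 := P) (P2 := Q) (P3 := Q3)) => //.
- by rewrite /distinguishes sQ3.
- by rewrite /distinguishes uQ.
by apply: contra nus => su; rewrite (maximal_in_le ms uR su) sep_le_refl.
Qed.

(** All that the recursion uses about [sigma], so that nestedness, distinguishing and the bound 4(p
    - 1) are proved once for both strategies. The third clause supplies the last hypothesis of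
    [hosted_card_upper]. *)
Definition good_choice (V : finType)
    (sigma : {set sep V} -> {set {set sep V}} -> {set sep V}) : Prop :=
  forall S PP, task S PP ->
  [/\ sigma S PP \subset relevant S PP /\ inv_closed (sigma S PP),
      forall s t, s \in sigma S PP -> t \in relevant S PP -> nested s t,
      forall s, s \in sigma S PP -> exists2 Q, Q \in PP &
        maximal_in (Q :&: sigma S PP) s ||
        maximal_in (Q :&: sigma S PP) (sep_inv s)
    & relevant S PP != set0 -> sigma S PP != set0].

(** * The choices [ext_r] and [loc_r] *)

Lemma extremalP (V : finType) (X : {set sep V}) (s : sep V) :
  reflect (s \in X /\ forall t, t \in X -> sep_le t s || sep_le (sep_inv t) s)
          (extremal X s).
Proof. by apply: (iffP andP) => -[sX h]; split=> //; apply/forall_inP. Qed.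

Lemma ext_r_closed (V : finType) (S : {set sep V}) (PP : {set {set sep V}}) :
  inv_closed (ext_r S PP).
Proof. by move=> s; rewrite !inE sep_invK orbC. Qed.

Lemma ext_r_sub (V : finType) (S : {set sep V}) (PP : {set {set sep V}}) :
  inv_closed S -> ext_r S PP \subset relevant S PP.
Proof.
move=> /(@relevant_closed _ _ PP) iR; apply/subsetP=> s; rewrite inE.
by case/orP=> /andP[] // h _; rewrite -(sep_invK s); apply: iR.
Qed.

(** An element of Q above s cannot have its inverse below s, so extremality puts it below s as
    well. *)
Lemma extremal_maximal (V : finType) (R Q : {set sep V}) (s : sep V) :
  consistent Q -> s \in Q -> extremal R s -> maximal_in (Q :&: R) s.
Proof.
move=> cQ sQ /extremalP[sR h]; rewrite /maximal_in inE sQ sR /=.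
apply/forall_inP=> t; rewrite inE => /andP[tQ tR]; apply/implyP=> st.
have := h t tR; rewrite (consistentW cQ sQ tQ) orbF => ts.
by rewrite (sep_le_anti ts st).
Qed.

Lemma maximal_in_sub (V : finType) (X Y : {set sep V}) (s : sep V) :
  X \subset Y -> s \in X -> maximal_in Y s -> maximal_in X s.
Proof.
move=> /subsetP XY sX ms; rewrite /maximal_in sX; apply/forall_inP=> t /XY tY.
by apply/implyP=> st; apply/eqP/(maximal_in_le ms).
Qed.

Lemma task_relevant_exists (V : finType) (S : {set sep V})
    (PP : {set {set sep V}}) :
  task S PP -> relevant S PP != set0 -> exists s, extremal (relevant S PP) s.
Proof.
move=> T /set0Pn[s0 /exists_maximal[s ms _]]; exists s.
exact: maximal_relevant_extremal.
Qed.

Lemma ext_r_good (V : finType) : good_choice (@ext_r V).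
Proof.
move=> S PP T; have sub := ext_r_sub PP (task_inv T).
have iR := relevant_closed (PP := PP) (task_inv T).
split.
- by split=> //; apply: ext_r_closed.
- move=> s t; rewrite inE => /orP[] /extremalP[_ h] tR.
    case/orP: (h t tR) => ts; first by rewrite nestedC nested_le.
    by rewrite -nested_invr nestedC nested_le.
  rewrite -nested_invl; case/orP: (h t tR) => ts; first by rewrite nestedC nested_le.
  by rewrite -nested_invr nestedC nested_le.
- move=> s sE; have main u : u \in ext_r S PP -> extremal (relevant S PP) u ->
      exists2 Q, Q \in PP & maximal_in (Q :&: ext_r S PP) u.
    move=> uE eu; have /relevantP[_ [Q [_ [QPP _ /andP[uQ _]]]]] := subsetP sub _ uE.
    exists Q => //; apply: maximal_in_sub (extremal_maximal (task_cons T QPP) uQ eu).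
      exact: setIS.
    by rewrite inE uQ.
  move: (sE); rewrite inE => /orP[es|es].
    by have [Q QPP mQ] := main _ sE es; exists Q; rewrite ?mQ.
  have [Q QPP mu] := main _ (ext_r_closed sE) es.
  by exists Q; rewrite // mu orbT.
move=> /(task_relevant_exists T)[s es]; apply/set0Pn; exists s.
by rewrite inE es.
Qed.

Lemma loc_r_closed (V : finType) (S : {set sep V}) (PP : {set {set sep V}}) :
  inv_closed (loc_r S PP).
Proof. by move=> s; rewrite !inE sep_invK orbC. Qed.

(** Oriented into P, t lies below a maximal m, and m is nested with s because P is well separated.
    Consistency rules out the one position in which t could still cross s. *)
Lemma locally_maximal_nested (V : finType) (S : {set sep V})
    (PP : {set {set sep V}}) (s t : sep V) :
  task S PP -> locally_maximal (relevant S PP) PP s -> t \in relevant S PP ->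
  nested s t.
Proof.
move=> T /exists_inP[P PPP /andP[/forallP ws ms]] tR.
have cP := task_cons T PPP; have sP : s \in P by case/andP: ms; case/setIP.
have below u : u \in P :&: relevant S PP -> nested s u.
  case/exists_maximal=> m mm um; have mP : m \in P by case/andP: mm; case/setIP.
  have mPR : m \in P :&: relevant S PP by case/andP: mm.
  have /forallP/(_ m) := ws s; rewrite ms mm => /or4P[sm|ms'|sm|].
  - rewrite nestedC nested_le //; apply: sep_le_trans um _.
    by rewrite (maximal_in_le ms mPR sm) sep_le_refl.
  - by rewrite nestedC nested_le //; apply: sep_le_trans um ms'.
  - rewrite nestedC -nested_invr nested_le //; apply: sep_le_trans um _.
    by rewrite sep_le_invr.
  - by rewrite (consistentW cP sP mP).
have [tP|tP] := boolP (t \in P); first by apply: below; rewrite inE tP.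
rewrite -nested_invr; apply: below.
have tS := subsetP (relevant_sub S PP) _ tR.
rewrite inE (orients_inv (task_orients T PPP) tS) tP relevant_closed //.
exact: task_inv T.
Qed.

Lemma loc_r_good (V : finType) : good_choice (@loc_r V).
Proof.
move=> S PP T; have iR := relevant_closed (PP := PP) (task_inv T).
have locR s : locally_maximal (relevant S PP) PP s -> s \in relevant S PP.
  by case/exists_inP=> P _ /andP[_ /andP[/setIP[]]].
have sub : loc_r S PP \subset relevant S PP.
  apply/subsetP=> s; rewrite inE => /orP[] /locR // h.
  by rewrite -(sep_invK s); apply: iR.
split.
- by split=> //; apply: loc_r_closed.
- move=> s t; rewrite inE => /orP[] ls tR.
    exact: locally_maximal_nested ls tR.
  rewrite -nested_invl; exact: locally_maximal_nested ls tR.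
- move=> s sL; have main u : u \in loc_r S PP ->
      locally_maximal (relevant S PP) PP u ->
      exists2 Q, Q \in PP & maximal_in (Q :&: loc_r S PP) u.
    move=> uL /exists_inP[Q QPP /andP[_ mu]]; exists Q => //.
    apply: maximal_in_sub (mu); first exact: setIS.
    by rewrite inE uL andbT; case/andP: mu => /setIP[].
  move: (sL); rewrite inE => /orP[es|es].
    by have [Q QPP mQ] := main _ sL es; exists Q; rewrite ?mQ.
  have [Q QPP mu] := main _ (loc_r_closed sL) es.
  by exists Q; rewrite // mu orbT.
move=> /(task_relevant_exists T)[s es]; apply/set0Pn; exists s.
have /extremalP[/relevantP[_ [Q [_ [QPP _ /andP[sQ _]]]]] h] := es.
have cQ := task_cons T QPP.
rewrite inE; apply/orP; left; apply/exists_inP; exists Q => //.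
rewrite (extremal_maximal cQ sQ es) andbT.
(* An extremal s is the only maximal element of the trace of Q, so Q is well separated and s is
   locally maximal. *)
have uniq u : maximal_in (Q :&: relevant S PP) u -> u = s.
  move=> mu; have /setIP[uQ uR] : u \in Q :&: relevant S PP by case/andP: mu.
  have := h u uR; rewrite (consistentW cQ sQ uQ) orbF => us.
  by rewrite (maximal_in_le mu _ us) // inE sQ; case/extremalP: es.
apply/forallP=> u; apply/forallP=> w; apply/implyP=> /andP[/uniq -> /uniq ->].
exact/nested_le/sep_le_refl.
Qed.

(** * Subtasks of a task *)

Lemma subprofilesP (V : finType) (PP : {set {set sep V}}) (O Q : {set sep V}) :
  reflect (Q \in PP /\ O \subset Q) (Q \in subprofiles PP O).
Proof. by rewrite inE; apply: andP. Qed.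

Lemma subprofiles_sub (V : finType) (PP : {set {set sep V}}) (O : {set sep V}) :
  subprofiles PP O \subset PP.
Proof. by apply/subsetP=> Q /subprofilesP[]. Qed.

(** P and Q witness the two consistency conditions: each contains O together with one orientation of
    s. *)
Lemma mem_subsystem (V : finType) (S N O P Q : {set sep V}) (s : sep V) :
  s \in S -> (forall t, t \in N -> nested s t) -> consistent P -> consistent Q ->
  O \subset P -> O \subset Q -> distinguishes s P Q -> s \in subsystem S N O.
Proof.
move=> sS sN cP cQ OP OQ /andP[sP sQ]; rewrite inE sS /=; apply/and3P; split.
- exact/forall_inP.
- by apply: consistent_sub cP; rewrite subUset sub1set sP.
- by apply: consistent_sub cQ; rewrite subUset sub1set sQ.
Qed.

Lemma subsystemP (V : finType) (S N O : {set sep V}) (s : sep V) :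
  s \in subsystem S N O ->
  [/\ s \in S, forall t, t \in N -> nested s t, consistent (s |: O)
    & consistent (sep_inv s |: O)].
Proof. by rewrite inE => /and4P[sS /forall_inP sN c1 c2]. Qed.

(** A corner obtained in S distinguishes two profiles containing O and is nested with N by
    [nested_join], so it remains in the subsystem. *)
Lemma subtask (V : finType) (S N O : {set sep V}) (PP : {set {set sep V}}) :
  task S PP -> task (subsystem S N O) (subprofiles PP O).
Proof.
move=> T; have subS := subsetP (subsystem_sub S N O).
split.
- move=> s; rewrite !inE sep_invK => /and4P[/(task_inv T) -> /forall_inP sN -> ->].
  by rewrite /= andbT; apply/forall_inP=> t /sN; rewrite nested_invl.
- move=> Q /subprofilesP[/(task_orients T) oQ _].
  exact: orients_sub (subsystem_sub _ _ _) oQ.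
- by move=> Q /subprofilesP[/(task_cons T)].
- by move=> Q s t /subprofilesP[QPP _]; exact: (task_profile T QPP).
- move=> s t P Q sS' tS' /subprofilesP[PPP OP] /subprofilesP[QPP OQ] ds dt.
  have [sS sN _ _] := subsystemP sS'; have [tS tN _ _] := subsystemP tS'.
  have jS := task_corner2 T sS tS PPP QPP ds dt.
  have [tP tQ] := andP dt; have [sP sQ] := andP ds.
  apply: (mem_subsystem (P := P) (Q := Q)) => //; try exact: (task_cons T).
    move=> u uN; apply: nested_join; [|exact: sN|exact: tN].
    by have := consistentW (task_cons T QPP) tQ sQ; rewrite sep_invK => ->.
  exact: (join_distinguishes T).
move=> s t P1 P2 P3 sS' tS' /subprofilesP[PPP1 OP1] /subprofilesP[PPP2 OP2].
move=> /subprofilesP[PPP3 OP3] sP1 tP1 ds dt nst.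
have [sS sN _ _] := subsystemP sS'; have [tS tN _ _] := subsystemP tS'.
have jS := task_corner3 T sS tS PPP1 PPP2 PPP3 sP1 tP1 ds dt nst.
apply: (mem_subsystem (P := P3) (Q := P2)) => //; try exact: (task_cons T).
  move=> u uN; apply: nested_join; [by rewrite sep_invK|exact: sN|].
  by rewrite nested_invl; apply: tN.
by apply: (join_distinguishes T) => //; case/andP: dt.
Qed.

(** * The recursion of a single strategy *)

Section StrategyRec.

Context (V : finType)
  (sigma : {set sep V} -> {set {set sep V}} -> {set sep V})
  (good : good_choice sigma).

Lemma strategy_rec_sub n (S : {set sep V}) (PP : {set {set sep V}}) :
  task S PP -> strategy_rec sigma n S PP \subset relevant S PP.
Proof.
elim: n S PP => [|n IH] S PP T /=; first exact: sub0set.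
case: ifP => _; first exact: sub0set.
have [[sub _] _ _ _] := good T; rewrite subUset sub /=.
apply/bigcupsP=> O _; apply: subset_trans (IH _ _ (subtask _ _ T)) _.
exact: relevant_mono (subsystem_sub _ _ _) (subprofiles_sub _ _).
Qed.

Lemma strategy_rec_closed n (S : {set sep V}) (PP : {set {set sep V}}) :
  task S PP -> inv_closed (strategy_rec sigma n S PP).
Proof.
elim: n S PP => [|n IH] S PP T s /=; first by rewrite inE.
case: ifP => _; first by rewrite inE.
have [[_ iN] _ _ _] := good T; rewrite !inE => /orP[/iN->//|/bigcupP[O OO sO]].
apply/orP; right; apply/bigcupP; exists O => //.
exact: IH (subtask _ _ T) _ sO.
Qed.

(** In the other two positions r is inconsistent with the orientation of s in P or in Q. *)
Lemma nested_compatible (r s : sep V) (P Q : {set sep V}) :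
  consistent P -> consistent Q -> r \in P -> r \in Q -> distinguishes s P Q ->
  nested r s -> sep_le r s || sep_le r (sep_inv s).
Proof.
move=> cP cQ rP rQ /andP[sP sQ] /or4P[->//|sr|->|sr].
- by move: (consistentW cQ rQ sQ); rewrite sep_invK sr.
- by rewrite orbT.
- by move: (consistentW cP rP sP); rewrite sr.
Qed.

(** Some orientation of s lies above r and some orientation of t above the inverse of r;
    transitivity through r makes s and t nested. This serves both for different branches of the
    recursion and for different tasks of one level. *)
Lemma nested_across (r s t : sep V) (P Q P' Q' : {set sep V}) :
  consistent P -> consistent Q -> consistent P' -> consistent Q' ->
  r \in P -> r \in Q -> distinguishes s P Q ->
  sep_inv r \in P' -> sep_inv r \in Q' -> distinguishes t P' Q' ->
  nested r s -> nested r t -> nested s t.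
Proof.
move=> cP cQ cP' cQ' rP rQ ds rP' rQ' dt nrs; rewrite -nested_invl => nrt.
have hs := nested_compatible cP cQ rP rQ ds nrs.
have ht := nested_compatible cP' cQ' rP' rQ' dt nrt.
have key u w : sep_le r u -> sep_le (sep_inv r) w -> nested u w.
  move=> ru rw; rewrite -nested_invl; apply: nested_le; apply: sep_le_trans rw.
  by rewrite sep_le_inv.
case/orP: hs => /key hs; case/orP: ht => /hs //.
- by rewrite nested_invr.
- by rewrite nested_invl.
- by rewrite nested_invl nested_invr.
Qed.

Lemma strategy_rec_nested n (S : {set sep V}) (PP : {set {set sep V}}) :
  task S PP -> pairwise_nested (strategy_rec sigma n S PP).
Proof.
elim: n S PP => [|n IH] S PP T s t /=; first by rewrite inE.
case: ifP => _; first by rewrite inE.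
have [[subN _] nN _ _] := good T; have subR := subsetP subN.
have recS O u : u \in strategy_rec sigma n (subsystem S (sigma S PP) O)
    (subprofiles PP O) -> u \in relevant (subsystem S (sigma S PP) O)
    (subprofiles PP O).
  exact/subsetP/strategy_rec_sub/subtask.
have recN O u r : u \in strategy_rec sigma n (subsystem S (sigma S PP) O)
    (subprofiles PP O) -> r \in sigma S PP -> nested r u.
  move=> /recS /relevantP[/subsystemP[_ uN _ _] _] rN.
  by rewrite nestedC; apply: uN.
rewrite !in_setU => /orP[sN|/bigcupP[O OO sO]] /orP[tN|/bigcupP[O' OO' tO]].
- exact/nN/subR.
- exact: recN tO sN.
- by rewrite nestedC; apply: recN sO tN.
have [EO|nO] := eqVneq O O'.
  by rewrite -EO in tO; apply: IH (subtask _ _ T) _ _ sO tO.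
move: OO OO'; rewrite !inE => /andP[/andP[ON /forall_inP oO] _].
case/andP=> /andP[ON' /forall_inP oO'] _.
have oN : orients_all (sigma S PP) O by move=> u /oO.
have oN' : orients_all (sigma S PP) O' by move=> u /oO'.
(* Different orientations of N disagree on some r, which has the two branches on opposite sides. *)
have [r rO rO'] : exists2 r, r \in O & r \notin O'.
  apply/subsetPn; apply: contra nO => sub; rewrite eqEsubset sub.
  apply/subsetP=> r rO'; have rN := subsetP ON' _ rO'.
  apply: contraT => rO; rewrite -(orients_inv oN rN) in rO.
  by move/(subsetP sub): rO; rewrite (orients_inv oN' rN) rO'.
have rN := subsetP ON _ rO.
rewrite -(orients_inv oN' rN) in rO'.
have /relevantP[_ [P [Q [/subprofilesP[PPP OP] /subprofilesP[QPP OQ] ds]]]] :=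
  recS _ _ sO.
have /relevantP[_ [P' [Q' [/subprofilesP[PPP' OP'] /subprofilesP[QPP' OQ'] dt]]]] :=
  recS _ _ tO.
apply: (nested_across (r := r) (P := P) (Q := Q) (P' := P') (Q' := Q')) => //.
all: try exact: (task_cons T).
- exact: (subsetP OP).
- exact: (subsetP OQ).
- exact: (subsetP OP').
- exact: (subsetP OQ').
- exact: recN sO rN.
- exact: recN tO rN.
Qed.

Lemma trace_cons_orientation (S N Q : {set sep V}) (PP : {set {set sep V}}) :
  task S PP -> N \subset S -> inv_closed N -> Q \in PP ->
  Q :&: N \in cons_orientations N.
Proof.
move=> T NS iN QPP; rewrite inE /orients subsetIr /=; apply/andP; split.
  apply/forall_inP=> s sN; rewrite !inE sN iN // !andbT.
  exact: orients_sub NS (task_orients T QPP) _ sN.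
exact: consistent_sub (subsetIl _ _) (task_cons T QPP).
Qed.

(** Either N itself distinguishes P and Q, or both induce the same orientation O of N, and r, being
    nested with N, remains in the subtask at O. *)
Lemma strategy_rec_distinguishes n (S : {set sep V}) (PP : {set {set sep V}})
    (P Q : {set sep V}) (r : sep V) :
  task S PP -> #|S| <= n -> P \in PP -> Q \in PP -> r \in S ->
  distinguishes r P Q ->
  exists2 s, s \in strategy_rec sigma n S PP & distinguishes s P Q.
Proof.
elim: n S PP => [|n IH] S PP T leS PPP QPP rS d.
  by move: leS; rewrite leqn0 cards_eq0 => /eqP S0; rewrite S0 inE in rS.
have rR : r \in relevant S PP by apply/relevantP; split=> //; exists P, Q.
have R0 : relevant S PP != set0 by apply/set0Pn; exists r.
rewrite /= (negbTE R0); have [[sub iN] nN _ N0] := good T.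
have NS := subset_trans sub (relevant_sub S PP).
have [/existsP[s /andP[sN ds]]|/existsPn nd] :=
    boolP [exists s, (s \in sigma S PP) && distinguishes s P Q].
  by exists s; rewrite // inE sN.
have EO : P :&: sigma S PP = Q :&: sigma S PP.
  apply/setP=> s; rewrite !inE; have [sN|] := boolP (s \in sigma S PP); last first.
    by rewrite !andbF.
  rewrite !andbT; have sS := subsetP NS _ sN.
  have := nd s; rewrite sN /distinguishes (orients_inv (task_orients T QPP) sS) /=.
  have := nd (sep_inv s); rewrite iN // /distinguishes sep_invK /=.
  rewrite (orients_inv (task_orients T PPP) sS).
  by case: (s \in P); case: (s \in Q).
pose O := P :&: sigma S PP.
have Ocons : O \in cons_orientations (sigma S PP).
  exact: trace_cons_orientation T NS iN PPP.
have OP : O \subset P by apply: subsetIl.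
have OQ : O \subset Q by rewrite /O EO subsetIl.
have := IH (subsystem S (sigma S PP) O) (subprofiles PP O) (subtask _ _ T).
case=> //.
(* The recursion depth suffices: N is nonempty, so the subsystem is strictly smaller. *)
- have /set0Pn[t tN] := N0 R0; rewrite -ltnS; apply: leq_trans leS.
  apply: proper_card; apply: (subsystem_proper (subsetP NS _ tN) tN).
  by move: Ocons; rewrite inE => /andP[].
- exact/subprofilesP.
- exact/subprofilesP.
- apply: (mem_subsystem (P := P) (Q := Q)) => //; try exact: (task_cons T).
  by move=> t tN; rewrite nestedC; apply: nN.
move=> s sO ds; exists s => //; rewrite inE; apply/orP; right.
by apply/bigcupP; exists O.
Qed.

Lemma card_bigcup_le (I T : finType) (A : {set I}) (F : I -> {set T}) :
  #|\bigcup_(i in A) F i| <= \sum_(i in A) #|F i|.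
Proof.
elim/big_rec2: _ => [|i m X _ le]; first by rewrite cards0.
by apply: leq_trans (leq_card_setU _ _) _; rewrite leq_add2l.
Qed.

(** If the p profiles induce h orientations of N, then N has at most 4(h - 1) elements, and the
    subtasks at these orientations add at most 4(p - h). *)
Lemma strategy_rec_card n (S : {set sep V}) (PP : {set {set sep V}}) :
  task S PP -> #|strategy_rec sigma n S PP| <= 4 * (#|PP| - 1).
Proof.
elim: n S PP => [|n IH] S PP T /=; first by rewrite cards0.
case: ifPn => [_|/set0Pn[r0 r0R]]; first by rewrite cards0.
have [[sub iN] nN maxN _] := good T.
have NS := subset_trans sub (relevant_sub S PP).
set N := sigma S PP in sub iN nN maxN NS *.
have traceC Q := trace_cons_orientation (Q := Q) T NS iN.
pose H : {set {set sep V}} := [set Q :&: N | Q in PP].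
have HC : H \subset cons_orientations N.
  by apply/subsetP=> _ /imsetP[Q QPP ->]; apply: traceC.
have oH O : O \in H -> orients_all N O /\ consistent O.
  by move=> /(subsetP HC); rewrite inE => /andP[/andP[_ /forall_inP o] c].
have cN : #|N| <= 4 * (#|H| - 1).
  apply: hosted_card_upper => //.
  - by move=> s t sN tN; apply: nN; rewrite // (subsetP sub).
  - move=> s sN; have /relevantP[_ [Q [_ [QPP _ /andP[sQ _]]]]] := subsetP sub _ sN.
    by exists (Q :&: N); rewrite ?inE ?sQ //; apply: imset_f.
  - move=> s sN; have [Q QPP mQ] := maxN _ sN; exists (Q :&: N).
      exact: imset_f.
    by rewrite -setIA setIid.
have trace O Q : O \in cons_orientations N -> Q \in subprofiles PP O ->
    Q :&: N = O.
  rewrite inE => /andP[/andP[ON /forall_inP oO] _] /subprofilesP[QPP OQ].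
  have oN : orients_all N O by move=> u /oO.
  have oQ := orients_sub NS (task_orients T QPP).
  apply/eqP; rewrite eqEsubset subsetI OQ ON !andbT.
  apply/subsetP=> s /setIP[sQ sN]; apply: contraT => sO.
  rewrite -(orients_inv oN sN) in sO.
  by move/(subsetP OQ): sO; rewrite (orients_inv oQ sN) sQ.
have sumH : \sum_(O in H) #|subprofiles PP O| = #|PP|.
  rewrite -[RHS]sum1_card [RHS](partition_big (fun Q => Q :&: N) (mem H)) /=; last first.
    by move=> Q QPP; apply: imset_f.
  apply: eq_bigr => O OH; rewrite -sum1_card; apply: eq_bigl => Q.
  apply/idP/andP => [QO|[QPP /eqP <-]]; last by apply/subprofilesP; rewrite subsetIl.
  rewrite (trace _ _ (subsetP HC _ OH) QO) eqxx.
  by case/subprofilesP: QO.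
have pos O : O \in H -> 0 < #|subprofiles PP O|.
  case/imsetP=> Q QPP ->; apply/card_gt0P; exists Q; apply/subprofilesP.
  by rewrite subsetIl.
have H0 : 0 < #|H|.
  have /relevantP[_ [Q [_ [QPP _ _]]]] := r0R.
  by apply/card_gt0P; exists (Q :&: N); apply: imset_f.
have sumH1 : \sum_(O in H) (#|subprofiles PP O| - 1) = #|PP| - #|H|.
  by rewrite sumnB // sumH sum1_card.
have HPP : #|H| <= #|PP| by apply: leq_imset_card.
apply: leq_trans (leq_card_setU _ _) _.
suff : #|\bigcup_(O in cons_orientations N)
      strategy_rec sigma n (subsystem S N O) (subprofiles PP O)|
    <= 4 * (#|PP| - #|H|).
  move=> cR; apply: leq_trans (leq_add cN cR) _.
  by rewrite -mulnDr leq_mul2l /= addnC addnBA // subnK.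
apply: leq_trans (card_bigcup_le _ _) _; rewrite -sumH1 big_distrr /=.
rewrite (bigID (mem H)) /= [X in _ + X]big1 ?addn0; last first.
  (* An orientation induced by no profile leaves its subtask without profiles, where truncated
     subtraction makes the bound 0. *)
  move=> O /andP[OC OH]; apply/eqP; rewrite -leqn0.
  suff E : subprofiles PP O = set0.
    by apply: leq_trans (IH _ _ (subtask _ _ T)) _; rewrite E cards0.
  apply/eqP/set0Pn => -[Q QO]; case/negP: OH.
  by rewrite -(trace _ _ OC QO); apply: imset_f; case/subprofilesP: QO.
apply: leq_trans (_ : \sum_(O in H) #|strategy_rec sigma n (subsystem S N O)
   (subprofiles PP O)| <= _).
  rewrite leq_eqVlt; apply/orP; left; apply/eqP/eq_bigl => O.
  by apply: andb_idl => /(subsetP HC).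
by apply: leq_sum => O _; apply/IH/subtask.
Qed.

End StrategyRec.

(* A profile containing an extremal s is the only one; the rest of the
   recursion happens at the orientation of N avoiding all extremal separations. *)
Lemma ext_rec_card (V : finType) n (S : {set sep V}) (PP : {set {set sep V}}) :
  task S PP -> #|strategy_rec (@ext_r V) n S PP| <= 2 * #|PP|.
Proof.
elim: n S PP => [|n IH] S PP T /=; first by rewrite cards0.
case: ifPn => [_|R0]; first by rewrite cards0.
set R := relevant S PP; set N := ext_r S PP.
have iR : inv_closed R := relevant_closed (PP := PP) (task_inv T).
have NR : N \subset R := ext_r_sub PP (task_inv T).
have RS : R \subset S := relevant_sub S PP.
have iN : inv_closed N := @ext_r_closed _ S PP.
pose E := [set s | extremal R s].
have ER s : s \in E -> s \in R by rewrite inE => /andP[].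
have EN s : s \in E -> s \in N by rewrite !inE => ->.
pose PE := [set Q in PP | [exists s in E, s \in Q]].
have cPE : #|E| <= #|PE|.
  (* [f] picks a profile containing the extremal s; relevance keeps it from the default. It is
     injective on [E]: two extremal separations in one consistent set lie below each other. *)
  pose f s := odflt set0 [pick Q : {set sep V} in PP | s \in Q].
  have fP s : s \in E -> f s \in PP /\ s \in f s.
    rewrite /f => /ER /relevantP[_ [Q [_ [QPP _ /andP[sQ _]]]]].
    by case: pickP => [Q' /andP[]//|/(_ Q)]; rewrite QPP sQ.
  rewrite -(card_in_imset (f := f) (D := E)).
    apply/subset_leq_card/subsetP=> _ /imsetP[s sE ->]; have [fs sf] := fP _ sE.
    by rewrite inE fs; apply/exists_inP; exists s.
  move=> s t sE tE ef; have [fs sf] := fP _ sE; have [_ tf] := fP _ tE.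
  rewrite -ef in tf; have cf := task_cons T fs.
  have sR := ER _ sE; have tR := ER _ tE.
  move: sE tE; rewrite !inE => /extremalP[_ hs] /extremalP[_ ht].
  have := hs t tR; have := ht s sR.
  rewrite !(consistentW cf) // !orbF; exact: sep_le_anti.
pose Oinf := [set sep_inv s | s in E].
have cN : #|N| <= 2 * #|E|.
  have -> : N = E :|: Oinf.
    apply/setP=> s; rewrite !inE; congr (_ || _).
    apply/idP/imsetP => [es|[u]]; first by exists (sep_inv s); rewrite ?inE ?sep_invK.
    by rewrite inE => eu ->; rewrite sep_invK.
  apply: leq_trans (leq_card_setU _ _) _.
  by rewrite mul2n -addnn leq_add2l leq_imset_card.
(* At an O containing an extremal s, all profiles agree on the relevant separations by
   [extremal_mem], so the subtask yields nothing. Any other orientation is [Oinf]. *)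
have sub : \bigcup_(O in cons_orientations N)
      strategy_rec (@ext_r V) n (subsystem S N O) (subprofiles PP O)
    \subset strategy_rec (@ext_r V) n (subsystem S N Oinf) (subprofiles PP Oinf).
  apply/bigcupsP=> O; rewrite inE => /andP[/andP[ON /forall_inP oO] cO].
  have oN : orients_all N O by move=> u /oO.
  have [/existsP[s /andP[sE sO]]|/existsPn noE] :=
      boolP [exists s, (s \in E) && (s \in O)].
    apply: subset_trans (strategy_rec_sub (@ext_r_good V) _ (subtask _ _ T)) _.
    apply/subsetP=> t /relevantP[tS' [P [Q [/subprofilesP[PPP OP]]]]].
    case/subprofilesP=> QPP OQ dt.
    have tS := subsetP (subsystem_sub _ _ _) _ tS'.
    have tR : t \in R by apply/relevantP; split=> //; exists P, Q.
    have h : sep_le t s || sep_le (sep_inv t) s.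
      by move: sE; rewrite inE => /extremalP[_ /(_ t tR)].
    have mem X : X \in PP -> O \subset X -> (t \in X) = sep_le t s.
      move=> XPP /subsetP OX.
      by apply: extremal_mem (task_orients T XPP) (task_cons T XPP) (OX _ sO) tS h.
    move: dt; rewrite /distinguishes (orients_inv (task_orients T QPP) tS).
    by rewrite (mem P PPP OP) (mem Q QPP OQ) andbN.
  suff -> : O = Oinf by [].
  apply/eqP; rewrite eqEsubset; apply/andP; split; apply/subsetP=> s.
    move=> sO; have := subsetP ON _ sO; rewrite inE => /orP[es|es].
      by have := noE s; rewrite inE es sO.
    by apply/imsetP; exists (sep_inv s); rewrite ?inE ?sep_invK.
  case/imsetP=> u uE ->; rewrite (orients_inv oN (EN _ uE)).
  by have := noE u; rewrite uE.
apply: leq_trans (leq_card_setU _ _) _.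
have := subset_leq_card sub; have := IH _ _ (subtask N Oinf T).
(* A profile containing [Oinf] contains no extremal separation, so it is not counted in [PE]. *)
have : #|subprofiles PP Oinf| + #|PE| <= #|PP|.
  rewrite -(cardsID PE PP) addnC leq_add //; apply: subset_leq_card.
    by apply/subsetP=> Q QE; rewrite inE QE andbT; move: QE; rewrite inE => /andP[].
  apply/subsetP=> Q /subprofilesP[QPP /subsetP OQ]; rewrite inE QPP andbT inE QPP.
  apply/exists_inPn=> s sE; have sS := subsetP RS _ (ER _ sE).
  by rewrite -(orients_inv (task_orients T QPP) sS); apply/OQ/imset_f.
move=> cP cI cS; apply: leq_trans (leq_add cN (leq_trans cS cI)) _.
rewrite -mulnDr leq_mul2l addnC /=; apply: leq_trans cP.
by rewrite leq_add2l.
Qed.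

(** * Profiles of increasing order *)

Lemma sep_order_inv (V : finType) (s : sep V) : sep_order (sep_inv s) = sep_order s.
Proof. by rewrite /sep_order setIC. Qed.

Lemma sep_order_submod (V : finType) (s t : sep V) :
  sep_order (sep_join s t) + sep_order (sep_meet s t) <= sep_order s + sep_order t.
Proof.
have cardE (A : {set V}) : #|A| = \sum_v (v \in A).
  by rewrite -sum1_card big_mkcond; apply: eq_bigr => v _; case: (v \in A).
rewrite /sep_order !cardE -!big_split /=.
(* The inequality already holds at each single vertex. *)
apply: leq_sum => v _; rewrite !inE.
by case: (v \in s.1); case: (v \in s.2); case: (v \in t.1); case: (v \in t.2).
Qed.

Lemma is_sepP (V : finType) (e : rel V) (s : sep V) :
  reflect ((forall v, (v \in s.1) || (v \in s.2)) /\
           forall x y, x \notin s.2 -> y \notin s.1 -> ~~ e x y)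
          (is_sep e s).
Proof.
apply: (iffP andP) => [[/eqP cov /forall_inP h]|[cov h]].
  have c v : (v \in s.1) || (v \in s.2) by rewrite -in_setU cov inE.
  split=> // x y xB yA.
  have xs : x \in s.1 :\: s.2 by have := c x; rewrite inE (negbTE xB) orbF.
  by apply: (forall_inP (h x xs)); have := c y; rewrite inE yA (negbTE yA).
split; first by apply/eqP/setP=> v; rewrite inE cov inE.
apply/forall_inP=> x; rewrite inE => /andP[xB _].
by apply/forall_inP=> y; rewrite inE => /andP[yA _]; apply: h.
Qed.

Lemma is_sep_inv (V : finType) (e : rel V) (s : sep V) :
  symmetric e -> is_sep e (sep_inv s) = is_sep e s.
Proof.
move=> e_sym; have imp t : is_sep e t -> is_sep e (sep_inv t).
  case/is_sepP=> cov h; apply/is_sepP; split=> [v|x y]; first by rewrite orbC.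
  by rewrite e_sym => xA yB; apply: h.
by apply/idP/idP=> /imp; rewrite ?sep_invK.
Qed.

Lemma is_sep_join (V : finType) (e : rel V) (s t : sep V) :
  is_sep e s -> is_sep e t -> is_sep e (sep_join s t).
Proof.
case/is_sepP=> covs hs /is_sepP[covt ht]; apply/is_sepP; split=> [v|x y] /=.
  rewrite !inE; move: (covs v) (covt v).
  by case: (v \in s.1); case: (v \in t.1) => //= -> ->.
rewrite !inE negb_and negb_or => /orP[xB|xD] /andP[yA yC]; first exact: hs.
exact: ht.
Qed.

Lemma seps_belowP (V : finType) (e : rel V) (n : nat) (s : sep V) :
  reflect (is_sep e s /\ sep_order s < n) (s \in seps_below e n).
Proof. by rewrite inE; apply: andP. Qed.

Lemma seps_below_closed (V : finType) (e : rel V) (n : nat) :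
  symmetric e -> inv_closed (seps_below e n).
Proof. by move=> e_sym s; rewrite !inE is_sep_inv // sep_order_inv. Qed.

Lemma seps_below_mono (V : finType) (e : rel V) (m n : nat) :
  m <= n -> seps_below e m \subset seps_below e n.
Proof.
move=> mn; apply/subsetP=> s /seps_belowP[ss sm].
by apply/seps_belowP; split=> //; apply: leq_trans mn.
Qed.

Lemma seps_below0 (V : finType) (e : rel V) : seps_below e 0 = set0.
Proof. by apply/setP=> s; rewrite !inE andbF. Qed.

Lemma k_profileP (V : finType) (e : rel V) (n : nat) (P : {set sep V}) :
  reflect [/\ P \subset seps_below e n, orients_all (seps_below e n) P,
              consistent P
            & forall s t, s \in P -> t \in P -> sep_inv (sep_join s t) \notin P]
          (k_profile e n P).
Proof.
apply: (iffP and3P) => [[/andP[sub /forall_inP o] c /forall_inP p]|[sub o c p]].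
  split=> // s t sP tP; exact: forall_inP (p s sP) t tP.
split=> //; first by rewrite /orients sub; apply/forall_inP.
by apply/forall_inP=> s sP; apply/forall_inP=> t tP; apply: p.
Qed.

Lemma k_profile_restrict (V : finType) (e : rel V) (m n : nat) (P : {set sep V}) :
  symmetric e -> m <= n -> k_profile e n P ->
  k_profile e m (P :&: seps_below e m).
Proof.
move=> e_sym mn /k_profileP[sub o c p]; apply/k_profileP; split.
- exact: subsetIr.
- move=> s sm; have := o s (subsetP (seps_below_mono e mn) _ sm).
  by rewrite !(in_setI _ P) sm seps_below_closed // !andbT.
- exact: consistent_sub (subsetIl _ _) c.
by move=> s t /setIP[sP _] /setIP[tP _]; rewrite in_setI negb_and p.
Qed.

Lemma orientation_eq (V : finType) (X P Q : {set sep V}) :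
  inv_closed X -> P \subset X -> orients_all X P -> orients_all X Q ->
  P \subset Q -> P = Q :&: X.
Proof.
move=> iX PX oP oQ PQ; apply/eqP; rewrite eqEsubset subsetI PQ PX /=.
apply/subsetP=> s /setIP[sQ sX]; apply: contraT => sP.
rewrite -(orients_inv oP sX) in sP.
by move/(subsetP PQ): sP; rewrite (orients_inv oQ sX) sQ.
Qed.

Definition traces (V : finType) (e : rel V) (PP : {set {set sep V}}) (l : nat) :
    {set {set sep V}} :=
  [set P :&: seps_below e l | P in PP].

(** By [orientation_eq], an l-profile contained in P is the trace of P. At level 0 the only element
    is the empty set, which is a trace because PP is nonempty. *)
Lemma ell_profilesE (V : finType) (e : rel V) (k l : nat)
    (PP : {set {set sep V}}) :
  symmetric e -> (forall P, P \in PP -> k_profile e k P) -> PP != set0 ->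
  l <= k -> ell_profiles e PP l = traces e PP l.
Proof.
move=> e_sym PPk /set0Pn[P0 P0P] lk; apply/setP=> Q; case: l lk => [|l] lk.
  rewrite inE; apply/eqP/imsetP=> [->|[P _ ->]]; last by rewrite seps_below0 setI0.
  by exists P0; rewrite // seps_below0 setI0.
rewrite inE; apply/andP/imsetP=> [[/k_profileP[sub o _ _]]|[P PPP ->]].
  case/exists_inP=> P PPP QP; exists P => //.
  apply: orientation_eq => //; first exact: seps_below_closed.
  have /k_profileP[_ oP _ _] := PPk _ PPP.
  exact: orients_sub (seps_below_mono e lk) oP.
split; first exact: k_profile_restrict lk (PPk _ PPP).
by apply/exists_inP; exists P; rewrite // subsetIl.
Qed.

Lemma nested_systemP (V : finType) (e : rel V) (N : {set sep V}) (m : nat)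
    (s : sep V) :
  reflect [/\ is_sep e s, sep_proper s, sep_order s = m
            & forall t, t \in N -> nested s t]
          (s \in nested_system e N m).
Proof.
by rewrite inE; apply: (iffP and4P) => -[ss sp so sN]; split=> //;
  [exact/eqP | exact/forall_inP | exact/eqP | exact/forall_inP].
Qed.

(** When one side contains the other, s in P or its inverse in Q is inconsistent with itself. *)
Lemma distinguishes_proper (V : finType) (s : sep V) (P Q : {set sep V}) :
  consistent P -> consistent Q -> distinguishes s P Q -> sep_proper s.
Proof.
move=> cP cQ /andP[sP sQ]; apply/andP; split; apply/negP => le.
  by move: (consistentW cQ sQ sQ); rewrite sep_invK /sep_le /= le.
by move: (consistentW cP sP sP); rewrite /sep_le /= le.
Qed.

Definition agree_below (V : finType) (e : rel V) (l : nat) (P Q : {set sep V}) :=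
  forall s, is_sep e s -> sep_order s < l -> (s \in P) = (s \in Q).

Lemma profile_join (V : finType) (e : rel V) (n : nat) (P : {set sep V})
    (s t : sep V) :
  k_profile e n P -> s \in P -> t \in P -> sep_order (sep_join s t) < n ->
  sep_join s t \in P.
Proof.
case/k_profileP=> /subsetP sub o _ p sP tP jn.
have /seps_belowP[ss _] := sub _ sP; have /seps_belowP[st _] := sub _ tP.
have jX : sep_join s t \in seps_below e n.
  by apply/seps_belowP; split=> //; apply: is_sep_join.
by have := p s t sP tP; rewrite (orients_inv o jX) negbK.
Qed.

Lemma join_distinguishes_profile (V : finType) (e : rel V) (n : nat)
    (P Q : {set sep V}) (s t : sep V) :
  symmetric e -> k_profile e n P -> k_profile e n Q -> t \in P ->
  distinguishes s P Q -> sep_order (sep_join s t) < n ->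
  distinguishes (sep_join s t) P Q.
Proof.
move=> e_sym kP kQ tP /andP[sP sQ] jn.
have jP := profile_join kP sP tP jn; rewrite /distinguishes jP /=.
have /k_profileP[/subsetP sub _ _ _] := kP; have jX := sub _ jP.
have /k_profileP[_ oQ cQ _] := kQ; rewrite (orients_inv oQ jX).
apply/negP => jQ; move: (consistentW cQ jQ sQ).
by rewrite sep_invK le_joinl.
Qed.

Lemma agree_order_ge (V : finType) (e : rel V) (l n : nat) (P Q : {set sep V})
    (s : sep V) :
  k_profile e n P -> k_profile e n Q -> agree_below e l P Q ->
  distinguishes s P Q -> l <= sep_order s.
Proof.
case/k_profileP=> /subsetP sub _ _ _ /k_profileP[_ o _ _] ag /andP[sP sQ].
have sX := sub _ sP; have /seps_belowP[ss _] := sX.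
rewrite leqNgt; apply/negP => sl; move: sQ.
by rewrite (orients_inv o sX) -(ag s ss sl) sP.
Qed.

(** As the profiles agree below l, a corner distinguishing two of them has order at least l. When
    the opposite corner does so too, submodularity forces order exactly l. *)
Lemma level_task (V : finType) (e : rel V) (l : nat) (N : {set sep V})
    (F : {set {set sep V}}) :
  symmetric e -> (forall P, P \in F -> k_profile e l.+1 P) ->
  (forall P Q, P \in F -> Q \in F -> agree_below e l P Q) ->
  task (nested_system e N l) F.
Proof.
move=> e_sym kF ag.
have consF P : P \in F -> consistent P by case/kF/k_profileP.
have order_ge s t P Q : P \in F -> Q \in F -> t \in P -> distinguishes s P Q ->
    l <= sep_order (sep_join s t).
  move=> PF QF tP d; rewrite leqNgt; apply/negP => jl.
  have := agree_order_ge (kF _ PF) (kF _ QF) (ag _ _ PF QF)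
    (join_distinguishes_profile e_sym (kF _ PF) (kF _ QF) tP d (ltnW jl)).
  by rewrite leqNgt jl.
(* P and Q bound the order of the corner from below, P' and Q' that of the opposite corner. *)
have corner s t P Q P' Q' : s \in nested_system e N l ->
    t \in nested_system e N l -> P \in F -> Q \in F -> P' \in F -> Q' \in F ->
    t \in P -> distinguishes s P Q ->
    sep_inv t \in P' -> distinguishes (sep_inv s) P' Q' ->
    ~~ sep_le s (sep_inv t) -> sep_join s t \in nested_system e N l.
  move=> /nested_systemP[ss _ os sN] /nested_systemP[st _ ot tN] PF QF PF' QF'.
  move=> tP d tP' d' nst.
  have ge1 := order_ge _ _ _ _ PF QF tP d.
  have ge2 := order_ge _ _ _ _ PF' QF' tP' d'.
  have ord : sep_order (sep_join s t) = l.
    have := sep_order_submod s t; rewrite os ot.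
    have -> : sep_order (sep_meet s t) = sep_order (sep_join (sep_inv s) (sep_inv t)).
      by rewrite -sep_order_inv.
    by move: ge1 ge2; lia.
  apply/nested_systemP; split=> //.
  - exact: is_sep_join.
  - apply: distinguishes_proper (consF _ PF) (consF _ QF) _.
    apply: (join_distinguishes_profile e_sym (kF _ PF) (kF _ QF)) => //.
    by rewrite ord.
  - by move=> u uN; apply: nested_join; [|exact: sN|exact: tN].
have below : nested_system e N l \subset seps_below e l.+1.
  apply/subsetP=> s /nested_systemP[ss _ os _]; apply/seps_belowP.
  by rewrite os.
have iS : inv_closed (nested_system e N l).
  move=> s /nested_systemP[ss sp so sN]; apply/nested_systemP; split.
  - by rewrite is_sep_inv.
  - by move: sp; rewrite /sep_proper andbC.
  - by rewrite sep_order_inv.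
  - by move=> t /sN; rewrite nested_invl.
split=> //.
- by move=> Q /kF /k_profileP[_ o _ _]; apply: orients_sub o.
- by move=> Q s t /kF /k_profileP[_ _ _ p]; apply: p.
- move=> s t P Q sS tS PF QF ds dt; have [tP tQ] := andP dt.
  have [sP sQ] := andP ds.
  apply: (corner s t P Q Q P) => //; first by rewrite /distinguishes sep_invK sQ.
  by have := consistentW (consF _ QF) tQ sQ; rewrite sep_invK => ->.
move=> s t P1 P2 P3 sS tS F1 F2 F3 s1 t1 ds dt nst.
have [t2 t3] := andP dt; have [s3 s2] := andP ds.
(* The corner distinguishes P3 from P2, the opposite corner P2 from P1. *)
apply: (corner s (sep_inv t) P3 P2 P2 P1) => //; rewrite ?sep_invK //.
- exact: iS.
- by rewrite /distinguishes s2 sep_invK.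
Qed.

(** The last clause makes t a distinguisher of K and K' of least order. *)
Definition efficient (V : finType) (e : rel V) (PP : {set {set sep V}})
    (t : sep V) : Prop :=
  is_sep e t /\ exists K K', [/\ K \in PP, K' \in PP, distinguishes t K K'
    & agree_below e (sep_order t) K K'].

(* If both corners of s on the t-side had larger order than s, the opposite
   corners would have order less than t; they lie in K, hence in K', and with the
   K'-orientation of s they violate the profile property of K'. *)
Lemma corner_order_le (V : finType) (e : rel V) (k : nat) (PP : {set {set sep V}})
    (s t : sep V) :
  symmetric e -> (forall P, P \in PP -> k_profile e k P) ->
  efficient e PP t -> is_sep e s -> sep_order s < k ->
  (sep_order (sep_join s t) <= sep_order s) ||
  (sep_order (sep_join (sep_inv s) t) <= sep_order s).
Proof.
move=> e_sym PPk [st [K [K' [KP KP' /andP[tK tK'] ag]]]] ss sk.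
apply: contraT; rewrite negb_or -!ltnNge => /andP[j1 j2].
have /k_profileP[subK oK cK _] := PPk _ KP.
have /k_profileP[_ oK' _ pK'] := PPk _ KP'.
have tk : sep_order t < k by have /seps_belowP[] := subsetP subK _ tK.
have meetK' u : is_sep e u -> sep_order u = sep_order s ->
    sep_order s < sep_order (sep_join u t) -> sep_meet u t \in K'.
  move=> su ou ju; have ot : sep_order (sep_meet u t) < sep_order t.
    by have := sep_order_submod u t; lia.
  have sm : is_sep e (sep_meet u t).
    rewrite -is_sep_inv // -[u]sep_invK -[t]sep_invK -sep_inv_join sep_invK.
    by apply: is_sep_join; rewrite is_sep_inv.
  rewrite -ag //; apply: down_closed oK cK _ tK _.
    by apply/seps_belowP; split=> //; apply: ltn_trans tk.
  by rewrite /sep_meet setIC setUC; apply: meet_le.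
have m1 := meetK' s ss erefl j1.
have m2 : sep_meet (sep_inv s) t \in K'.
  by apply: meetK' j2; rewrite ?is_sep_inv ?sep_order_inv.
have [sK|] := boolP (s \in K').
  by have := pK' _ _ sK tK'; rewrite sep_inv_join sep_invK m2.
have sX : s \in seps_below e k by apply/seps_belowP.
rewrite -(orients_inv oK' sX) => sK.
by have := pK' _ _ sK tK'; rewrite sep_inv_join !sep_invK m1.
Qed.

(** If s crosses some t in N, a corner of the two replaces s: it still has order l by
    [corner_order_le], and it crosses fewer members of N, being nested with t and, by [nested_join],
    with all members nested with s. *)
Lemma nested_distinguisher (V : finType) (e : rel V) (k l : nat)
    (PP : {set {set sep V}}) (N P Q : {set sep V}) (s : sep V) :
  symmetric e -> (forall P, P \in PP -> k_profile e k P) -> l < k ->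
  inv_closed N -> pairwise_nested N ->
  (forall t, t \in N -> efficient e PP t /\ sep_order t < l) ->
  P \in PP -> Q \in PP -> agree_below e l P Q -> sep_order s = l ->
  distinguishes s P Q ->
  exists2 r, r \in nested_system e N l & distinguishes r P Q.
Proof.
move=> e_sym PPk lk iN nN effN.
have [n] := ubnP #|[set t in N | ~~ nested s t]|.
elim: n s P Q => // n IH s P Q ltn PPP QPP ag os ds.
have kP := PPk _ PPP; have kQ := PPk _ QPP.
have [/k_profileP[subP oP cP _] /k_profileP[_ oQ cQ _]] := (kP, kQ).
have [sP sQ] := andP ds.
have ss : is_sep e s by have /seps_belowP[] := subsetP subP _ sP.
have [/existsP[t0 /andP[t0N nt0]]|/existsPn all] :=
    boolP [exists t, (t \in N) && ~~ nested s t]; last first.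
  exists s => //; apply/nested_systemP; split=> //.
    exact: distinguishes_proper ds.
  by move=> t tN; have := all t; rewrite tN negbK.
(* Up to inversion t lies in P, hence also in Q because its order is below l. *)
have [t [tN nt tP]] : exists t, [/\ t \in N, ~~ nested s t & t \in P].
  have [t0P|t0P] := boolP (t0 \in P); first by exists t0.
  exists (sep_inv t0); rewrite iN // nested_invr; split=> //.
  have [[st0 _] ot0] := effN _ t0N; rewrite (orients_inv oP) //.
  by apply/seps_belowP; split=> //; apply: ltn_trans lk.
have [eft ot] := effN _ tN.
have tQ : t \in Q by rewrite -(ag t) //; case: eft.
have fewer u : nested u t -> (forall r, r \in N -> nested s r -> nested u r) ->
    #|[set t in N | ~~ nested u t]| < n.
  move=> ut ur; rewrite -ltnS; apply: leq_trans ltn; rewrite ltnS.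
  apply/proper_card/properP; split.
    apply/subsetP=> r; rewrite !inE => /andP[rN]; rewrite rN /=.
    by apply: contra; apply: ur.
  by exists t; rewrite !inE tN // ut.
have cross u : ~~ nested u t -> ~~ sep_le u (sep_inv t).
  by apply: contra => ut; rewrite -nested_invr nested_le.
have join_t u : nested (sep_join u t) t by rewrite nestedC nested_le // le_joinr.
have corner u : ~~ nested u t -> (forall r, r \in N -> nested s r -> nested u r) ->
    forall r, r \in N -> nested s r -> nested (sep_join u t) r.
  move=> nut ur r rN sr; apply: nested_join; [exact: cross|exact: ur|exact: nN].
have := corner_order_le e_sym PPk eft ss; rewrite os => /(_ lk) /orP[jl|jl].
  have dj : distinguishes (sep_join s t) P Q.
    by apply: (join_distinguishes_profile e_sym kP kQ) => //; apply: leq_ltn_trans lk.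
  apply: (IH (sep_join s t)) => //.
    by apply: fewer => //; apply: corner.
  by apply/eqP; rewrite eqn_leq jl (agree_order_ge kP kQ ag dj).
(* The corner with the inverse of s distinguishes Q from P, so the roles are exchanged and the
   separation found is inverted at the end. *)
have ag' : agree_below e l Q P by move=> u su uo; rewrite ag.
have dj : distinguishes (sep_join (sep_inv s) t) Q P.
  apply: (join_distinguishes_profile e_sym kQ kP) => //; last exact: leq_ltn_trans lk.
  by rewrite /distinguishes sep_invK sQ.
case: (IH (sep_join (sep_inv s) t) Q P) => //.
- apply: fewer => //; apply: corner => [|r rN]; first by rewrite nested_invl.
  by rewrite nested_invl.
- by apply/eqP; rewrite eqn_leq jl (agree_order_ge kQ kP ag' dj).
move=> r rS /andP[rQ rP]; exists (sep_inv r); last first.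
  by rewrite /distinguishes sep_invK rP.
have /nested_systemP[sr pr or rN] := rS; apply/nested_systemP; split.
- by rewrite is_sep_inv.
- by move: pr; rewrite /sep_proper andbC.
- by rewrite sep_order_inv.
- by move=> u /rN; rewrite nested_invl.
Qed.

Definition extensions (V : finType) (e : rel V) (PP : {set {set sep V}}) (l : nat)
    (P : {set sep V}) : {set {set sep V}} :=
  [set Q in traces e PP l.+1 | P \subset Q].

(** * The levels of an iterated strategy *)

Section Levels.

Context (V : finType) (e : rel V) (k : nat) (PP : {set {set sep V}})
  (e_sym : symmetric e) (PPk : forall P, P \in PP -> k_profile e k P)
  (PP0 : PP != set0).

Lemma traces_agree l P Q : P \in PP -> Q \in PP ->
  P :&: seps_below e l = Q :&: seps_below e l -> agree_below e l P Q.
Proof.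
move=> PPP QPP E s ss so; have /setP/(_ s) := E.
have sX : s \in seps_below e l by apply/seps_belowP.
by rewrite !in_setI sX !andbT.
Qed.

Lemma orients_below l P : P \in PP -> l <= k -> orients_all (seps_below e l) P.
Proof.
move=> /PPk /k_profileP[_ o _ _] lk; exact: orients_sub (seps_below_mono e lk) o.
Qed.

Lemma subset_trace l P Q : P \in PP -> Q \in PP -> l < k ->
  P :&: seps_below e l \subset Q :&: seps_below e l.+1 ->
  P :&: seps_below e l = Q :&: seps_below e l.
Proof.
move=> PPP QPP lk; rewrite subsetI => /andP[sub _].
have := orientation_eq (seps_below_closed e_sym) _ _ _ sub; apply.
- exact: subsetIr.
- move=> s sl; rewrite !(in_setI _ P) sl seps_below_closed // !andbT.
  exact: (orients_below PPP (ltnW lk)).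
- exact: orients_below (ltnW lk).
Qed.

Lemma extensionsP l P Q : P \in traces e PP l -> l < k ->
  reflect (exists K, [/\ K \in PP, Q = K :&: seps_below e l.+1
                       & P = K :&: seps_below e l])
          (Q \in extensions e PP l P).
Proof.
move=> PT lk; rewrite inE; apply: (iffP andP).
  have /imsetP[K0 K0P ->] := PT.
  case=> /imsetP[K KP ->] sub; exists K; split=> //.
  exact: subset_trace sub.
case=> K [KP -> ->]; split; first exact: imset_f.
by rewrite setIS // seps_below_mono.
Qed.

Lemma extensions_task l N P : P \in traces e PP l -> l < k ->
  task (nested_system e N l) (extensions e PP l P).
Proof.
move=> PT lk; apply: level_task => // [Q|Q Q'].
  case/(extensionsP _ PT lk)=> K [KP -> _].
  exact: k_profile_restrict (PPk KP).
case/(extensionsP _ PT lk)=> K [KP -> EK] /(extensionsP _ PT lk)[K' [KP' -> EK']].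
move=> s ss so; rewrite !in_setI (traces_agree KP KP' _ ss so) //.
by rewrite -EK.
Qed.

(** Each trace on the next level extends only its own restriction, so the sets of extensions
    partition that level. *)
Lemma sum_extensions l : l < k ->
  \sum_(P in traces e PP l) #|extensions e PP l P| = #|traces e PP l.+1|.
Proof.
move=> lk; rewrite -[RHS]sum1_card.
rewrite [RHS](partition_big (fun Q => Q :&: seps_below e l) (mem (traces e PP l))).
  apply: eq_bigr => P PT; rewrite -sum1_card; apply: eq_bigl => Q.
  have E (K : {set sep V}) :
      K :&: seps_below e l.+1 :&: seps_below e l = K :&: seps_below e l.
    by rewrite -setIA (setIidPr (seps_below_mono e (leqnSn l))).
  apply/(extensionsP _ PT lk)/andP => [[K [KP -> ->]]|[/imsetP[K KP ->] /eqP <-]].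
    by rewrite E; split=> //; apply: imset_f.
  by exists K.
move=> _ /imsetP[K KP ->].
by rewrite -setIA (setIidPr (seps_below_mono e (leqnSn l))); apply: imset_f.
Qed.

Lemma extensions_gt0 l P : P \in traces e PP l -> l < k ->
  0 < #|extensions e PP l P|.
Proof.
move=> PT lk; have /imsetP[K KP E] := PT; apply/card_gt0P.
exists (K :&: seps_below e l.+1); apply/(extensionsP _ PT lk); by exists K.
Qed.

Lemma iterated_strategyS sigma l : l < k ->
  let N := iterated_strategy e sigma PP l in
  iterated_strategy e sigma PP l.+1 =
    N :|: \bigcup_(P in traces e PP l)
            strategy sigma (nested_system e N l) (extensions e PP l P).
Proof.
move=> lk N /=; congr (_ :|: _); rewrite (ell_profilesE e_sym PPk PP0 (ltnW lk)).
apply: eq_bigr => P _; congr strategy.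
have := ell_profilesE e_sym PPk PP0 lk; rewrite /ell_profiles => ->.
by apply/setP=> Q; rewrite !inE.
Qed.

(** The four properties need a joint induction: earlier distinguishers keep the tasks of one level
    apart, and efficiency lets new distinguishers avoid the earlier levels. *)
Lemma iterated_strategy_spec sigma l : good_choice sigma -> l <= k ->
  let N := iterated_strategy e sigma PP l in
  [/\ inv_closed N, pairwise_nested N,
      forall t, t \in N -> efficient e PP t /\ sep_order t < l
    & forall P Q s, P \in PP -> Q \in PP -> sep_order s < l ->
        distinguishes s P Q -> exists2 r, r \in N & distinguishes r P Q].
Proof.
move=> good; elim: l => [|l IH] lk N; first by split=> [s|s t|t|]; rewrite ?inE.
have [iN' nN' effN' dN'] := IH (ltnW lk).
rewrite /N iterated_strategyS //.
set N' := iterated_strategy e sigma PP l in iN' nN' effN' dN' *.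
have T P PT := extensions_task N' (P := P) PT lk.
have rel P s (PT : P \in traces e PP l) :
    s \in strategy sigma (nested_system e N' l) (extensions e PP l P) ->
    [/\ is_sep e s, sep_order s = l, forall t, t \in N' -> nested s t
      & exists K K', [/\ K \in PP, K' \in PP, P = K :&: seps_below e l,
          P = K' :&: seps_below e l & distinguishes s K K']].
  move/(subsetP (strategy_rec_sub good _ (T P PT))) => /relevantP[].
  case/nested_systemP=> ss _ os sN [Q [Q' [+ + /andP[]]]].
  case/(extensionsP _ PT lk)=> K [KP -> E].
  case/(extensionsP _ PT lk)=> K' [KP' -> E'] /setIP[sK _] /setIP[sK' _].
  by split=> //; exists K, K'; rewrite /distinguishes sK.
split.
- move=> s; rewrite !in_setU => /orP[/iN' ->//|/bigcupP[P PT sP]].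
  apply/orP; right; apply/bigcupP; exists P => //.
  exact: strategy_rec_closed (T P PT) _ sP.
- move=> s t; rewrite !in_setU.
  case/orP=> [sN|/bigcupP[P PT sP]] /orP[tN|/bigcupP[P' PT' tP]].
  + exact: nN'.
  + by have [_ _ tN _] := rel _ _ PT' tP; rewrite nestedC; apply: tN.
  + by have [_ _ sN _] := rel _ _ PT sP; apply: sN.
  have [EP|nP] := eqVneq P P'.
    by rewrite -EP in tP; apply: strategy_rec_nested (T P PT) _ _ sP tP.
  have [_ _ sN [K [K' [KP KP' E E' ds]]]] := rel _ _ PT sP.
  have [_ _ tN [L [L' [LP LP' F F' dt]]]] := rel _ _ PT' tP.
  (* K and L have different traces, so by induction an earlier r distinguishes them; it is nested
     with s and t and has them on opposite sides. *)
  have [r0 r0l dr0] : exists2 r, sep_order r < l & distinguishes r K L.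
    have oL := orients_below LP (ltnW lk).
    have oK := orients_below KP (ltnW lk).
    have [r rK rL] : exists2 r, r \in K :&: seps_below e l & r \notin L.
      apply/subsetPn; apply: contra nP => sub; apply/eqP; rewrite F E.
      apply: (orientation_eq (seps_below_closed e_sym)) => //.
        exact: subsetIr.
      move=> s0 sl; rewrite !(in_setI _ K) sl seps_below_closed // !andbT.
      exact: oK.
    have [rK' rl] := setIP rK; exists r.
      by case/seps_belowP: rl.
    by rewrite /distinguishes rK' (orients_inv oL rl).
  have [r rN /andP[rK rL]] := dN' _ _ _ KP LP r0l dr0.
  have [[sr _] ro] := effN' _ rN.
  have agK := traces_agree KP KP' (etrans (esym E) E').
  have agL := traces_agree LP LP' (etrans (esym F) F').
  have cons X : X \in PP -> consistent X by case/PPk/k_profileP.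
  apply: (nested_across (r := r) (P := K) (Q := K') (P' := L) (Q' := L')) => //.
  all: try exact: cons.
  + by rewrite -agK.
  + by rewrite -agL // ?is_sep_inv ?sep_order_inv.
  + by rewrite nestedC; apply: sN.
  + by rewrite nestedC; apply: tN.
- move=> t; rewrite in_setU => /orP[/effN'[eft ot]|/bigcupP[P PT tP]].
    by split=> //; apply: ltnW.
  have [st ot _ [K [K' [KP KP' E E' dt]]]] := rel _ _ PT tP.
  rewrite ot; split=> //; split=> //; exists K, K'; split=> //.
  by rewrite ot; apply: traces_agree => //; rewrite -E.
move=> P Q s PPP QPP so ds.
have oQ := orients_below QPP (ltnW lk).
have oP := orients_below PPP (ltnW lk).
(* Profiles differing below order l were distinguished on an earlier level. Otherwise s has order
   exactly l and can be replaced by a distinguisher nested with the earlier levels, which belongs to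
   the new task. *)
have [E|nE] := eqVneq (P :&: seps_below e l) (Q :&: seps_below e l); last first.
  have [r rP rQ] : exists2 r, r \in P :&: seps_below e l & r \notin Q.
    apply/subsetPn; apply: contra nE => sub; apply/eqP.
    apply: (orientation_eq (seps_below_closed e_sym)) => //.
      exact: subsetIr.
    move=> s0 sl; rewrite !(in_setI _ P) sl seps_below_closed // !andbT.
    exact: oP.
  have [rP' rl] := setIP rP; have rQ' : sep_inv r \in Q by rewrite (orients_inv oQ rl).
  have ro : sep_order r < l by case/seps_belowP: rl.
  have dr : distinguishes r P Q by rewrite /distinguishes rP'.
  by have [u uN du] := dN' _ _ _ PPP QPP ro dr; exists u; rewrite // inE uN.
have ag := traces_agree PPP QPP E.
have os : sep_order s = l.
  apply/eqP; rewrite eqn_leq -ltnS so.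
  exact: agree_order_ge (PPk PPP) (PPk QPP) ag ds.
have [r rS dr] :=
  nested_distinguisher e_sym PPk lk iN' nN' effN' PPP QPP ag os ds.
have PT : P :&: seps_below e l \in traces e PP l by apply: imset_f.
have PX : P :&: seps_below e l.+1 \in extensions e PP l (P :&: seps_below e l).
  by apply/(extensionsP _ PT lk); exists P.
have QX : Q :&: seps_below e l.+1 \in extensions e PP l (P :&: seps_below e l).
  by apply/(extensionsP _ PT lk); exists Q.
have dr' : distinguishes r (P :&: seps_below e l.+1) (Q :&: seps_below e l.+1).
  have /nested_systemP[sr _ or _] := rS; have [rP rQ] := andP dr.
  have rX : r \in seps_below e l.+1 by apply/seps_belowP; rewrite or.
  by rewrite /distinguishes !in_setI rP rQ rX seps_below_closed.
have := strategy_rec_distinguishes good (T _ PT) (leqnn _) PX QX rS dr'.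
case=> u uN /andP[/setIP[uP _] /setIP[uQ _]]; exists u.
  by rewrite in_setU; apply/orP; right; apply/bigcupP; exists (P :&: seps_below e l).
by rewrite /distinguishes uP.
Qed.

Lemma traces_gt0 l : 0 < #|traces e PP l|.
Proof.
have /set0Pn[P PPP] := PP0; apply/card_gt0P; exists (P :&: seps_below e l).
exact: imset_f.
Qed.

Lemma traces_full : traces e PP k = PP.
Proof.
have E P : P \in PP -> P :&: seps_below e k = P.
  by case/PPk/k_profileP=> sub _ _ _; apply/setIidPl.
apply/setP=> Q; apply/imsetP/idP=> [[P PPP ->]|QPP]; first by rewrite E.
by exists Q; rewrite ?E.
Qed.

(** A level adds at most four times the increase in the number of traces, and these increases
    telescope. *)
Lemma iterated_strategy_card sigma l : good_choice sigma -> l <= k ->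
  #|iterated_strategy e sigma PP l| <= 4 * (#|traces e PP l| - 1).
Proof.
move=> good; elim: l => [|l IH] lk; first by rewrite cards0.
rewrite iterated_strategyS //; apply: leq_trans (leq_card_setU _ _) _.
set N := iterated_strategy e sigma PP l.
have sumE : \sum_(P in traces e PP l) (#|extensions e PP l P| - 1) =
    #|traces e PP l.+1| - #|traces e PP l|.
  by rewrite sumnB ?sum_extensions ?sum1_card // => P PT; apply: extensions_gt0.
have le : #|traces e PP l| <= #|traces e PP l.+1|.
  rewrite -sum_extensions // -sum1_card; apply: leq_sum => P PT.
  exact: extensions_gt0.
have cR : #|\bigcup_(P in traces e PP l)
      strategy sigma (nested_system e N l) (extensions e PP l P)|
    <= 4 * (#|traces e PP l.+1| - #|traces e PP l|).
  apply: leq_trans (card_bigcup_le _ _) _; rewrite -sumE big_distrr /=.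
  apply: leq_sum => P PT; have T := extensions_task N PT lk.
  exact: (strategy_rec_card good).
apply: leq_trans (leq_add (IH (ltnW lk)) cR) _.
by rewrite -mulnDr leq_mul2l /= addnC addnBA ?traces_gt0 // subnK.
Qed.

Lemma iterated_strategy_bounds sigma : good_choice sigma ->
  2 * (#|PP| - 1) <= #|iterated_strategy e sigma PP k| <= 4 * (#|PP| - 1).
Proof.
move=> good; apply/andP; split; last first.
  by have := iterated_strategy_card good (leqnn k); rewrite traces_full.
have [iN nN effN dN] := iterated_strategy_spec good (leqnn k).
apply: distinguishing_card_lower => //.
  move=> P PPP; have /k_profileP[_ o c _] := PPk PPP; split=> //.
  apply: orients_sub o; apply/subsetP=> t /effN[[st _] ot].
  exact/seps_belowP.
move=> P Q PPP QPP nPQ; have /k_profileP[subP oP _ _] := PPk PPP.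
have /k_profileP[_ oQ _ _] := PPk QPP.
have [r rP rQ] : exists2 r, r \in P & r \notin Q.
  apply/subsetPn; apply: contra nPQ => sub; apply/eqP.
  rewrite (orientation_eq (seps_below_closed e_sym) subP oP oQ sub).
  by apply/setIidPl; have /k_profileP[] := PPk QPP.
have rX := subsetP subP _ rP; have /seps_belowP[_ ro] := rX.
by apply: dN PPP QPP ro _; rewrite /distinguishes rP (orients_inv oQ rX).
Qed.

(** A proper separation has vertices strictly on both sides, so its separator would separate the
    graph with fewer than k - 1 vertices. *)
Lemma connected_nested_system N l : n_connected e (k - 1) -> l < k - 1 ->
  nested_system e N l = set0.
Proof.
case/andP=> _ /forallP sep lk; apply/setP=> s; rewrite in_set0.
apply/negP => /nested_systemP[/is_sepP[cov h] /andP[/subsetPn[x xA xB]]].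
case/subsetPn=> y yB yA os _.
have := sep (s.1 :&: s.2); rewrite -/(sep_order s) os lk /= => /negP[].
apply/existsP; exists x; rewrite !inE (negbTE xB) andbF /=.
apply/existsP; exists y; rewrite !inE (negbTE yA) /=.
set r := [rel u v | _]; apply/negP => xy.
(* An edge avoiding the separator cannot leave the strict first side. *)
have cl : closed r [pred v | v \in s.1 :\: s.2].
  apply: intro_closed => [|u v]; last first.
    rewrite !inE => /and3P[uX vX uv] /andP[uB uA].
    have vA : v \in s.1 by apply: contraLR uv => vA; apply: h.
    by rewrite vA andbT; apply: contra vX => vB; rewrite in_setI vA vB.
  apply: sym_connect_sym => u v /=; rewrite e_sym.
  by rewrite andbCA.
by have := closed_connect cl xy; rewrite !inE xA xB (negbTE yA) andbF.
Qed.

(** Only separations of order k - 1 contribute. [ext_rec_card] bounds each task on that level, and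
    the profile sets of these tasks partition PP. *)
Lemma iterated_ext_connected : 0 < k -> n_connected e (k - 1) ->
  #|iterated_strategy e (@ext_r V) PP k| <= 2 * #|PP|.
Proof.
move=> k0 conn; have empty l : l <= k - 1 ->
    iterated_strategy e (@ext_r V) PP l = set0.
  elim: l => // l IH lk; rewrite iterated_strategyS ?(IH (ltnW lk)); last by lia.
  rewrite set0U big1 // => P _; rewrite connected_nested_system //.
  by rewrite /strategy cards0.
have lk : k - 1 < k by lia.
have -> : iterated_strategy e (@ext_r V) PP k =
    iterated_strategy e (@ext_r V) PP (k - 1).+1 by congr iterated_strategy; lia.
rewrite iterated_strategyS // empty // set0U.
apply: leq_trans (card_bigcup_le _ _) _.
have -> : #|PP| = #|traces e PP (k - 1).+1|.
  by rewrite -[in LHS]traces_full; congr #|pred_of_set (traces e PP _)|; lia.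
rewrite -sum_extensions // big_distrr /=; apply: leq_sum => P PT.
exact/ext_rec_card/extensions_task.
Qed.

End Levels.

(** Level 0 still has the empty profile to extend, but every task has an empty profile set and hence
    no relevant separation. *)
Lemma iterated_strategy_noprofile (V : finType) (e : rel V)
    (sigma : {set sep V} -> {set {set sep V}} -> {set sep V}) (k : nat) :
  iterated_strategy e sigma set0 k = set0.
Proof.
have strat S : strategy sigma S set0 = set0.
  rewrite /strategy; case: #|S| => //= n; rewrite ifT //.
  apply/eqP/setP=> s; rewrite in_set0; apply/negP => /relevantP[_ [P [Q []]]].
  by rewrite inE.
elim: k => //= k ->; rewrite set0U big1 // => P _.
apply: etrans (strat (nested_system e set0 k)); congr strategy.
apply/setP=> Q; rewrite !inE; apply/negP => /andP[/andP[_ /exists_inP[P0]]].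
by rewrite inE.
Qed.

Theorem theorem2p2 (V : finType) (e : rel V)
    (e_sym : symmetric e) (e_irr : irreflexive e)
    (k : nat) (k_ge1 : 1 <= k)
    (PP : {set {set sep V}}) (PPk : forall P, P \in PP -> k_profile e k P) :
  [/\ 2 * (#|PP| - 1) <= #|N_Ext e k PP| <= 4 * (#|PP| - 1),
      2 * (#|PP| - 1) <= #|N_Loc e k PP| <= 4 * (#|PP| - 1)
    & n_connected e (k - 1) -> #|N_Ext e k PP| <= 2 * #|PP|].
Proof.
rewrite /N_Ext /N_Loc; have [->|PP0] := eqVneq PP set0.
  (* Truncated subtraction turns [0 - 1] into 0, so every bound reads 0. *)
  by rewrite !iterated_strategy_noprofile !cards0.
split.
- exact (iterated_strategy_bounds e_sym PPk PP0 (@ext_r_good V)).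
- exact (iterated_strategy_bounds e_sym PPk PP0 (@loc_r_good V)).
- exact: iterated_ext_connected.
Qed.
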